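(* Let $\beta \in (0,\pi/2)$ and, for each $\nu > 0$, let $\theta_\nu$ be a minimizer of $E_\beta^\nu$ over $\mathcal{A}$. Then, as $\nu \to 0$, the minimizers $\theta_\nu$ converge uniformly on $[0,+\infty)$ to the function $$\theta_0(x) = 2\arctan\left( e^{-x}\tan\frac{\beta}{2} \right),$$ which is the minimizer over $\mathcal{A}$ of $$E_\beta^0(\theta) = \frac12\int_0^\infty \left( |\theta'|^2 + \sin^2\theta \right) dx.$$
   Context: Notation: $\mathbb{R}^+ = (0,\infty)$ and $\overline{\mathbb{R}^+} = [0,\infty)$; all functions are real valued. $\mathring{H}^1_0(\mathbb{R}^+)$ is the Hilbert space obtained as the completion of $C^\infty_c(\mathbb{R}^+)$ with respect to the norm $\|u\|^2_{\mathring{H}^1_0(\mathbb{R}^+)} := \int_0^\infty |u'|^2\,dx$; its elements are identified with continuous functions on $[0,\infty)$ vanishing at $x=0$. The admissible class is $$\mathcal{A} := \{ \theta \in C(\overline{\mathbb{R}^+}) : \theta - \beta \in \mathring{H}^1_0(\mathbb{R}^+) \}.$$ $\eta_\beta : \mathbb{R} \to [0,\beta]$ is a fixed smooth cutoff function (independent of $\nu$) with $\eta_\beta(x) = \beta$ for $x \le 0$, $\eta_\beta(x) = 0$ for $x \ge 1$, and $\eta_\beta'(x) \le 0$ for all $x \in \mathbb{R}$. For $\nu>0$ and $\theta \in \mathcal{A}$ the renormalized energy is $$E_\beta^\nu(\theta) = \int_0^\infty \left( \tfrac12 |\theta'|^2 + \tfrac12 \sin^2\theta + \frac{\nu}{4\pi}\cdot\frac{\sin^2(\theta-\beta)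 - \sin^2(\eta_\beta - \beta)}{x} \right) dx + \frac{\nu}{8\pi}\int_0^\infty\int_0^\infty \frac{(\sin(\theta(x)-\beta) - \sin(\theta(y)-\beta))^2}{(x-y)^2}\,dx\,dy - \frac{\nu}{8\pi}\int_0^\infty\int_0^\infty \frac{(\sin(\eta_\beta(x)-\beta) - \sin(\eta_\beta(y)-\beta))^2}{(x-y)^2}\,dx\,dy.$$ The integrand of the first integral is bounded from below by an integrable function not depending on $\theta$, the second term is nonnegative, and the last term is a finite constant, so $E_\beta^\nu(\theta) \in (-\infty,+\infty]$ is well defined on $\mathcal{A}$. A minimizer of $E^\nu_\beta$ over $\mathcal A$ is a $\theta\in\mathcal A$ with $E^\nu_\beta(\theta)=\inf_{\tilde\theta\in\mathcal A}E^\nu_\beta(\tilde\theta)$ (this infimum is finite). *)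

(* Defs.v *)
From HB Require Import structures.
From mathcomp Require Import all_boot all_order all_algebra.
From mathcomp Require Import all_classical all_reals all_analysis.

Set Implicit Arguments.
Unset Strict Implicit.
Unset Printing Implicit Defensive.

Import Order.TTheory GRing.Theory Num.Theory.
Import numFieldNormedType.Exports.

Local Open Scope classical_set_scope.
Local Open Scope ring_scope.

(* A function on [0, +oo[ is represented by a function on R, whose values on
   the negative half-line are never used. *)

Definition Rpos (R : realType) : set R := `]0, +oo[.
Arguments Rpos R : clear implicits.

Definition Rpos_closed (R : realType) : set R := `[0, +oo[.
Arguments Rpos_closed R : clear implicits.

Definition smooth (R : realType) (f : R -> R) : Prop :=
  forall (n : nat) (x : R), derivable (derive1n n f) x 1.

Definition test_function (R : realType) (f : R -> R) : Prop :=
  [/\ smooth f,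
      compact (closure [set x | f x != 0]) &
      closure [set x | f x != 0] `<=` Rpos R].

(* The completion of the test functions for the norm of f' in L^2(0, +oo),
   realized inside the continuous functions on [0, +oo[ times L^2(0, +oo).
   Since |f(x)|^2 <= x * |f'|_2^2, a sequence of test functions that is Cauchy
   for the norm converges pointwise (locally uniformly) to a function u, while
   its derivatives converge in L^2 to some g, the derivative of u.  Square
   integrability of g is implied by the convergence. *)
Definition H10_derivative (R : realType) (u g : R -> R) : Prop :=
  measurable_fun (Rpos R) g /\
  exists phi : nat -> R -> R,
    [/\ forall n, test_function (phi n),
        (\int[@lebesgue_measure R]_(x in Rpos R)
          (((phi n)^`()%classic x - g x) ^+ 2)%:E)%E @[n --> \oo] --> 0%E &
        forall x, 0 <= x -> phi n x @[n --> \oo] --> u x].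

Definition H10 (R : realType) : set (R -> R) :=
  [set u : R -> R | exists g, H10_derivative u g].

(* The derivative is determined almost everywhere only; a representative is
   chosen. *)
Definition deriv_H10 (R : realType) (u : R -> R) : R -> R :=
  xget (fun=> 0) [set g | H10_derivative u g].

Definition admissible (R : realType) (beta : R) : set (R -> R) :=
  [set theta : R -> R | {within Rpos_closed R, continuous theta} /\
               H10 (fun x => theta x - beta)].

(* beta is a constant, so theta' is the derivative of theta - beta. *)
Definition deriv_adm (R : realType) (beta : R) (theta : R -> R) : R -> R :=
  deriv_H10 (fun x => theta x - beta).

Definition cutoff (R : realType) (beta : R) (eta : R -> R) : Prop :=
  [/\ smooth eta,
      forall x, 0 <= eta x <= beta,
      forall x, x <= 0 -> eta x = beta,
      forall x, 1 <= x -> eta x = 0 &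
      forall x, eta^`()%classic x <= 0].

(* On the diagonal, a null set, the integrand is 0 since 0^-1 = 0. *)
Definition nonlocal_term (R : realType) (beta : R) (theta : R -> R) : \bar R :=
  (\int[@lebesgue_measure R]_(y in Rpos R)
    \int[@lebesgue_measure R]_(x in Rpos R)
      ((sin (theta x - beta) - sin (theta y - beta)) ^+ 2 / (x - y) ^+ 2)%:E)%E.

Definition local_term (R : realType) (beta nu : R) (eta theta : R -> R)
  : \bar R :=
  (\int[@lebesgue_measure R]_(x in Rpos R)
    (2^-1 * (deriv_adm beta theta x) ^+ 2 + 2^-1 * (sin (theta x)) ^+ 2
     + nu / (4 * pi)
       * (((sin (theta x - beta)) ^+ 2 - (sin (eta x - beta)) ^+ 2) / x))%:E)%E.

Definition energy (R : realType) (beta nu : R) (eta theta : R -> R) : \bar R :=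
  (local_term beta nu eta theta
   + (nu / (8 * pi))%:E * nonlocal_term beta theta
   - (nu / (8 * pi))%:E * nonlocal_term beta eta)%E.

Definition energy0 (R : realType) (beta : R) (theta : R -> R) : \bar R :=
  ((2^-1)%:E * \int[@lebesgue_measure R]_(x in Rpos R)
     ((deriv_adm beta theta x) ^+ 2 + (sin (theta x)) ^+ 2)%:E)%E.

Definition minimizer (R : realType) (A : set (R -> R)) (E : (R -> R) -> \bar R)
    (theta : R -> R) : Prop :=
  A theta /\ E theta = ereal_inf [set E t | t in A].

Definition theta0 (R : realType) (beta : R) : R -> R :=
  fun x => 2 * atan (expR (- x) * tan (beta / 2)).

(* Main.v *)
(* The proof rests on a calibration argument.  Since t^2 + s^2 >= 2 |t s|, the
   energy E^0 spent between two points bounds the variation of cos theta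
   (Bogomolny).  As |cos theta| tends to 1 along a sequence, a profile with
   E^0(theta) < 1 cannot reach cos theta = cos(beta)/2, so it stays in
   ]-pi/2, pi/2[, and completing the square gives
     1/2 int |theta' + sin theta|^2 <= E^0(theta) - (1 - cos beta).
   Comparing with theta_0' = - sin theta_0, which contracts distances in that
   region, yields the stability estimate
     cos(beta)/2 * (theta - theta_0)^2 <= E^0(theta) - (1 - cos beta)
   at every point.  It contains both the minimality and the uniqueness of
   theta_0.  The nu-dependent part of the energy is bounded from below by
   - nu (int sin^2 theta / 2 + C), and from above at theta_0 by C nu, so that
   E^0(theta_nu) <= (1 - cos beta + C nu) / (1 - nu). *)
Require Import Defs.
From mathcomp Require Import all_boot all_order all_algebra.
From mathcomp Require Import all_classical all_reals all_analysis.
From mathcomp Require Import measurable_realfun ring lra.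
Import Order.TTheory GRing.Theory Num.Theory.
Import numFieldNormedType.Exports.
Local Open Scope classical_set_scope.
Local Open Scope ring_scope.

Set Implicit Arguments.
Unset Strict Implicit.
Unset Printing Implicit Defensive.

(** * The profile [theta0] and calculus on an interval *)

(** The approximants of an admissible profile are [beta + phi n] with [phi n] compactly supported:
    they equal [beta] near infinity, so their energy on the half-line is infinite. Stability is
    therefore proved on bounded intervals [[0, X]] with [e < |cos (T X)|]. This strict inequality
    replaces the condition at infinity and, like the strict upper bound on the energy, survives
    approximation. The threshold [cos beta / 2] is dictated by the cost of reaching it: the descent
    from [cos beta] already spends [cos beta / 2], and any continuation to [X], toward 1 or toward
    -1, then brings the total to at least [|cos (T X)|]. The derivative inside the energy is a
    chosen representative. The lower bounds hold for any choice, whereas the exact energy of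
    [theta0] requires the derivative to be identified almost everywhere. All tails are measured by
    the single weight [1 / (1 + x^2)], whose integral over the half-line is [pi / 2]. *)

Lemma is_derive_theta0 (R : realType) (beta x : R) :
  is_derive x 1 (theta0 beta) (- sin (theta0 beta x)).
Proof.
set s := expR (- x) * tan (beta / 2).
have ds : is_derive x 1 (fun y => expR (- y) * tan (beta / 2)) (- s).
  have -> : (fun y => expR (- y) * tan (beta / 2)) =
      tan (beta / 2) \*: (expR \o -%R).
    by apply/funext => y; rewrite /= mulrC.
  by apply: is_derive_eq; rewrite /s /GRing.scale /=; ring.
(* Half-angle formula with [s = tan (theta0 x / 2)]. Since [s' = - s], the derivative of [2 atan s]
   is [- 2 s / (1 + s^2)]. *)
have -> : sin (theta0 beta x) = 2 * s / (1 + s ^+ 2).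
  rewrite /theta0 -/s; set a := atan s.
  have ca : cos a != 0.
    by rewrite gt_eqF// cos_gt0_pihalf// atan_gtNpi2 atan_ltpi2.
  have sa : sin a = s * cos a by rewrite -[s in RHS]atanK /tan -/a divfK.
  have := cos2_tan2 ca; rewrite atanK => <-.
  by rewrite mulr_natl sin_mulr2n sa invrK -mulr_natl; ring.
have -> : theta0 beta = 2 \*: (atan \o fun y => expR (- y) * tan (beta / 2)).
  by apply/funext.
apply: is_derive_eq.
by rewrite /GRing.scale /= -/s; ring.
Qed.

Lemma is_derive_continuous (R : realType) (f : R -> R) (df x : R) :
  is_derive x 1 f df -> {for x, continuous f}.
Proof.
by move=> [dfx _]; apply: differentiable_continuous; exact/derivable1_diffP.
Qed.

Lemma continuous_theta0 (R : realType) (beta : R) : continuous (theta0 beta).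
Proof. by move=> x; exact: is_derive_continuous (is_derive_theta0 _ _). Qed.

Section theta0_bounds.
Variables (R : realType) (beta : R).
Hypothesis hbeta : 0 < beta < pi / 2.

Let tan_gt0 : 0 < tan (beta / 2).
Proof.
have p0 := @pi_gt0 R; have /andP[b0 bp] := hbeta.
by rewrite -tan0 ltr_tan ?in_itv/=; lra.
Qed.

Lemma theta0_0 : theta0 beta 0 = beta.
Proof.
have p0 := @pi_gt0 R; have /andP[b0 bp] := hbeta.
rewrite /theta0 oppr0 expR0 mul1r tanK; last by rewrite in_itv/=; lra.
by field.
Qed.

Lemma theta0_gt0 x : 0 < theta0 beta x.
Proof.
rewrite /theta0 mulr_gt0//; have := @lt_atan R 0 (expR (- x) * tan (beta / 2)).
by rewrite atan0; apply; rewrite mulr_gt0// expR_gt0.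
Qed.

Lemma theta0_ninc : {homo theta0 beta : x y /~ x <= y}.
Proof.
move=> x y xy; rewrite /theta0 ler_pM2l//; apply: le_atan.
by rewrite ler_pM2r// ler_expR lerN2.
Qed.

Lemma theta0_le x : 0 <= x -> theta0 beta x <= beta.
Proof. by move=> x0; rewrite -[leRHS]theta0_0; exact: theta0_ninc. Qed.

End theta0_bounds.

Section mean_value.
Variable R : realType.
Implicit Types (f df : R -> R) (a b : R).

Lemma MVT_lipschitz f df (M a b : R) : a <= b ->
  (forall x, a < x < b -> is_derive x 1 f (df x)) ->
  {within `[a, b], continuous f} ->
  (forall x, a < x < b -> `|df x| <= M) ->
  `|f b - f a| <= M * (b - a).
Proof.
rewrite le_eqVlt => /predU1P[<- _ _ _|ab fdf fc dfM].
  by rewrite !subrr normr0 mulr0.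
have [c + ->] : exists2 c, c \in `]a, b[ & f b - f a = df c * (b - a).
  by apply: MVT => // x; rewrite in_itv; exact: fdf.
rewrite in_itv/= => cab; rewrite normrM (ger0_norm (_ : 0 <= b - a)); last by lra.
by rewrite ler_wpM2r ?dfM//; lra.
Qed.

Lemma is_derive_ndecr f df (a b : R) :
  {within `[a, b], continuous f} ->
  (forall x, a < x < b -> is_derive x 1 f (df x)) ->
  (forall x, a < x < b -> 0 <= df x) ->
  forall x y, a <= x -> x <= y -> y <= b -> f x <= f y.
Proof.
move=> fc fdf df0; apply: ger0_derive1_ndecr => //.
  by move=> x; rewrite in_itv => /fdf[].
by move=> x; rewrite in_itv derive1E => /[dup]/fdf[_ ->]; exact: df0.
Qed.

(** Supplies the energy spent up to a point as a differentiable function, so that calibration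
    inequalities become statements of monotonicity. *)
Lemma primitive f (a b : R) : a <= b -> {within `[a, b], continuous f} ->
  (forall x, a < x < b -> {for x, continuous f}) ->
  exists F : R -> R, [/\ F a = 0,
    (\int[@lebesgue_measure R]_(x in `[a, b]) (f x)%:E = (F b)%:E)%E,
    {within `[a, b], continuous F} &
    forall x, a < x < b -> is_derive x 1 F (f x)].
Proof.
move=> ab fc fc'.
have fi : (@lebesgue_measure R).-integrable `[a, b] (EFin \o f).
  by apply: continuous_compact_integrable => //; exact: segment_compact.
exists (fun x => \int[@lebesgue_measure R]_(t in `[a, x]) f t)%R; split.
- by rewrite set_itv1 Rintegral_set1.
- by rewrite /Rintegral fineK//; exact: integrable_fin_num.
- exact: (parameterized_integral_continuous ab fi).
- move=> x /[dup] /fc' fx /andP[ax xb].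
  by have [? ?] := continuous_FTC1_closed xb fi ax fx; apply: DeriveDef => //; rewrite -derive1E.
Qed.

Lemma no_crossing f (b v : R) : {within `[0, b], continuous f} -> f 0 < v ->
  (forall x, 0 <= x <= b -> f x != v) -> forall x, 0 <= x <= b -> f x < v.
Proof.
move=> fc f0 fv x /andP[x0 xb]; rewrite ltNge; apply/negP => vx.
have fc' : {within `[0, x], continuous f}.
  by apply: continuous_subspaceW fc; exact: subset_itvl.
have [c] : exists2 c, c \in `[0, x] & f c = v.
  by apply: IVT => //; rewrite ge_min le_max vx orbT (ltW f0).
rewrite in_itv/= => /andP[c0 cx] fcv.
by have := fv c; rewrite fcv eqxx c0 (le_trans cx xb) => /(_ isT).
Qed.

(** On []-pi/2, pi/2[] the cosine increases and then decreases, so on a segment it is smallest at an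
    end; the mean value theorem concludes. This is the contraction of the flow [T' = - sin T] where
    [cos >= c]. *)
Lemma sin_contraction (c a b : R) :
  - (pi / 2) < a < pi / 2 -> - (pi / 2) < b < pi / 2 ->
  c <= cos a -> c <= cos b ->
  c * (a - b) ^+ 2 <= (sin a - sin b) * (a - b).
Proof.
have p0 := @pi_gt0 R.
have le_cos u v : 0 <= u <= v -> v < pi / 2 -> cos v <= cos u.
  move=> /andP[u0]; rewrite le_eqVlt => /predU1P[-> //|uv] vp.
  by rewrite ltW// ltr_cos ?in_itv/= ?u0//; lra.
wlog ab : a b / a <= b.
  move=> h ha hb ca cb; have [/h|/ltW/h] := leP a b; first exact.
  by move=> /(_ hb ha cb ca); nra.
move=> /andP[a1 a2] /andP[b1 b2] ca cb.
move: ab; rewrite le_eqVlt => /predU1P[->|ab]; first by rewrite !subrr; lra.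
have [x + sab] : exists2 x, x \in `]a, b[ & sin b - sin a = cos x * (b - a).
  by apply: MVT => //; apply: continuous_subspaceT => x; exact: continuous_sin.
rewrite in_itv/= => /andP[ax xb].
have cx : c <= cos x.
  have [x0|x0] := leP 0 x.
    by rewrite (le_trans cb)// le_cos//; lra.
  by rewrite (le_trans ca)// -(cosN a) -(cosN x) le_cos//; lra.
have := ler_wpM2r (sqr_ge0 (b - a)) cx.
have -> : (sin a - sin b) * (a - b) = (sin b - sin a) * (b - a) by ring.
rewrite sab; lra.
Qed.

End mean_value.

Lemma continuous_integrable_oc (R : realType) (f : R -> R) (a b : R) :
  continuous f -> (@lebesgue_measure R).-integrable `]a, b] (EFin \o f).
Proof.
move=> fc; have fi : (@lebesgue_measure R).-integrable `[a, b] (EFin \o f).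
  apply: continuous_compact_integrable; first exact: segment_compact.
  by apply: continuous_subspaceT => x; exact: fc.
apply: integrableS fi => //; exact: subset_itv_oc_cc.
Qed.

Lemma integral_cst_itv (R : realType) (k a b : R) (c d : bool) : a < b ->
  (\int[@lebesgue_measure R]_(x in [set` Interval (BSide c a) (BSide d b)]) k%:E =
   (k * (b - a))%:E)%E.
Proof.
move=> ab; have mI : measurable [set` Interval (BSide c a) (BSide d b)].
  exact: measurable_itv.
rewrite integral_cst//=.
by rewrite lebesgue_measure_itv/= lte_fin ab.
Qed.

(** * The stability estimate *)

Section stability.
Variables (R : realType) (beta : R) (T dT : R -> R) (X e : R).
Hypothesis hbeta : 0 < beta < pi / 2.
Hypothesis X0 : 0 < X.
Hypothesis dTP : forall x : R, is_derive x 1 T (dT x).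
Hypothesis dTc : continuous dT.
Hypothesis T0 : T 0 = beta.
Hypothesis eE : (\int[@lebesgue_measure R]_(x in `[0%R, X])
  (2^-1 * dT x ^+ 2 + 2^-1 * sin (T x) ^+ 2)%:E = e%:E)%E.
Hypothesis eX : e < `|cos (T X)|.

Let Tc : continuous T.
Proof. by move=> x; exact: is_derive_continuous (dTP x). Qed.

Lemma smooth_stability : 0 <= cos (T X) /\
  forall x, 0 <= x <= X ->
    cos beta / 2 * (T x - theta0 beta x) ^+ 2 <= e + cos beta - cos (T X).
Proof.
have /andP[b0 bp] := hbeta; have p0 := @pi_gt0 R.
pose c := cos beta / 2.
have cb0 : 0 < cos beta by rewrite cos_gt0_pihalf//; lra.
pose L x := 2^-1 * dT x ^+ 2 + 2^-1 * sin (T x) ^+ 2.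
have Lc : continuous L.
  move=> x; apply: cvgD; apply: cvgM; try exact: cvg_cst.
    apply: (@continuous_comp _ _ _ dT (fun x => x ^+ 2)); first exact: dTc.
    exact: exprn_continuous.
  apply: (@continuous_comp _ _ _ (sin \o T) (fun x => x ^+ 2)).
    by apply: continuous_comp; [exact: Tc|exact: continuous_sin].
  exact: exprn_continuous.
have LcX : {within `[0, X], continuous L} by exact: continuous_subspaceT.
have [P [P0 PX Pc dP]] := primitive (ltW X0) LcX (fun x _ => Lc x).
have {}PX : P X = e by move: PX; rewrite eE => -[].
have cTc : {within `[0, X], continuous (cos \o T)}.
  apply: continuous_subspaceT => x.
  by apply: continuous_comp; [exact: Tc|exact: continuous_cos].
have Lcos x : `|dT x * sin (T x)| <= L x.
  rewrite ler_norml /L; apply/andP; split.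
    by have := sqr_ge0 (dT x + sin (T x)); lra.
  by have := sqr_ge0 (dT x - sin (T x)); lra.
(* Bogomolny's inequality: the energy spent between two points bounds the
   variation of cos (T x). *)
have PmN : forall x y, 0 <= x -> x <= y -> y <= X ->
    (P - (cos \o T)) x <= (P - (cos \o T)) y.
  apply: (@is_derive_ndecr R _ (fun x => L x + dT x * sin (T x))).
  - by move=> x; apply: cvgB; [exact: Pc|exact: cTc].
  - by move=> x /dP dPx; apply: is_derive_eq; lra.
  - by move=> x _; have := Lcos x; rewrite ler_norml => /andP[]; lra.
have PpN : forall x y, 0 <= x -> x <= y -> y <= X ->
    (P + (cos \o T)) x <= (P + (cos \o T)) y.
  apply: (@is_derive_ndecr R _ (fun x => L x - dT x * sin (T x))).
  - by move=> x; apply: cvgD; [exact: Pc|exact: cTc].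
  - by move=> x /dP dPx; apply: is_derive_eq; lra.
  - by move=> x _; have := Lcos x; rewrite ler_norml => /andP[]; lra.
(* If [c] were reached at [x], going down from [cos beta = 2 c] would cost at least [c], and going
   on to [X] at least [|cos (T X) - c|]. The total is at least [|cos (T X)|], against [eX]. *)
have cN x : 0 <= x <= X -> cos (T x) != c.
  move=> /andP[x0 xX]; apply/eqP => cx.
  have := PpN 0 x (lexx _) x0 xX; have := PmN x X x0 xX (lexx _).
  have := PpN x X x0 xX (lexx _).
  rewrite !fctE P0 PX T0 /= cx => h1 h2 h3.
  by case: (ger0P (cos (T X))) eX => ? ?; rewrite /c in h1 h2 h3; lra.
have cgt x : 0 <= x <= X -> c < cos (T x).
  move=> xX; rewrite -ltrN2; apply: (@no_crossing R (- (cos \o T)) X (- c)) => //.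
  - by move=> y; apply: cvgN; exact: cTc.
  - by rewrite fctE/= T0 /c; lra.
  - by move=> y yX; rewrite fctE/= eqr_opp; exact: cN.
have Trange x : 0 <= x <= X -> - (pi / 2) < T x < pi / 2.
  move=> xX; apply/andP; split.
    rewrite -ltrN2 opprK; apply: (@no_crossing R (- T) X (pi / 2)) => //.
    - by apply: continuous_subspaceT => y; apply: cvgN; exact: Tc.
    - by rewrite fctE T0; lra.
    - move=> y yX; apply/eqP; rewrite fctE => Ty.
      by have := cgt _ yX; rewrite -cosN Ty cos_pihalf /c; lra.
  apply: (@no_crossing R T X (pi / 2)) => //.
  - exact: continuous_subspaceT.
  - by rewrite T0.
  - move=> y yX; apply/eqP => Ty.
    by have := cgt _ yX; rewrite Ty cos_pihalf /c; lra.
have cX : c < cos (T X) by apply: cgt; rewrite lexx (ltW X0).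
split; first by rewrite /c in cX; lra.
(* Put [v = T' + sin T] and [D = T - theta0]. Then [Q' = v^2 / 2 - 2 c D v + 2 c D (sin T - sin
   theta0)], whose last term is at least [2 c^2 D^2] by [sin_contraction]. Hence
   [Q' >= (v - 2 c D)^2 / 2]. *)
pose Q := P - (cos \o T) - c \*: (T - theta0 beta) ^+ 2.
have QN : forall x y, 0 <= x -> x <= y -> y <= X -> Q x <= Q y.
  apply: (@is_derive_ndecr R _ (fun x => L x + dT x * sin (T x) -
     c * (2 * (T x - theta0 beta x) * (dT x + sin (theta0 beta x))))).
  - move=> x; apply: cvgB; first by apply: cvgB; [exact: Pc|exact: cTc].
    apply: (@continuous_subspaceT _ _ _ (c \*: (T - theta0 beta) ^+ 2)) => y.
    have dTh := is_derive_theta0 beta y.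
    by apply: is_derive_continuous.
  - move=> x /dP dPx; have dTh := is_derive_theta0 beta x.
    by apply: is_derive_eq; rewrite /GRing.scale /= !fctE; ring.
  - move=> x /andP[x0 xX].
    have xX' : 0 <= x <= X by lra.
    have th0 := theta0_gt0 hbeta x; have th1 := theta0_le hbeta (ltW x0).
    have cth : c <= cos (theta0 beta x).
      rewrite (@le_trans _ _ (cos beta))//; first by rewrite /c; lra.
      move: th1; rewrite le_eqVlt => /predU1P[->//|th1].
      by rewrite ltW// ltr_cos ?in_itv//=; lra.
    have := sin_contraction (Trange _ xX') _ (ltW (cgt _ xX')) cth.
    move=> /(_ ltac:(lra)); rewrite /L.
    have := sqr_ge0 (dT x + sin (T x) - 2 * c * (T x - theta0 beta x)).
    have c0 : 0 < c by rewrite /c; lra.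
    move=> h1 h2; have {h2} := ler_wpM2l (ltW c0) h2.
    move: h1; move: (T x) (dT x) (theta0 beta x) => t p th.
    move: (sin t) (sin th) => st sth; nra.
move=> x /andP[x0 xX]; have := QN 0 x (lexx _) x0 xX.
have := PmN _ _ x0 xX (lexx _).
by rewrite /Q !fctE /= P0 PX T0 theta0_0// subrr expr0n /= /GRing.scale /= /c; lra.
Qed.

End stability.

(** * Measurability and elementary properties of test functions *)

Section preliminaries.
Variable R : realType.
Notation mu := (@lebesgue_measure R).

Lemma small_factor (a d : R) : 0 <= a -> 0 < d ->
  exists2 s, 0 < s & s * a <= d.
Proof.
move=> a0 d0; exists (d / (a + 1)); first by rewrite divr_gt0//; lra.
rewrite mulrAC -mulrA ler_piMr //; first exact: ltW.
by rewrite ler_pdivrMr; lra.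
Qed.

Lemma cvge0_lt (a : nat -> \bar R) (d : R) : a n @[n --> \oo] --> 0%E ->
  0 < d -> \forall n \near \oo, (a n < d%:E)%E.
Proof. by move=> a0 d0; exact: a0 (nbhs_open_ereal_lt (f := fun=> d) d0). Qed.

Lemma measurable_sin_comp (D : set R) (f : R -> R) :
  measurable_fun D f -> measurable_fun D (fun x => sin (f x)).
Proof.
by apply: measurableT_comp; apply: continuous_measurable_fun; exact: continuous_sin.
Qed.

Lemma measurable_Rpos : measurable (Rpos R).
Proof. exact: measurable_itv. Qed.

Lemma within_Rpos_measurable (f : R -> R) :
  {within Rpos_closed R, continuous f} -> measurable_fun (Rpos R) f.
Proof.
move=> fc; apply: (@measurable_funS _ _ _ _ (Rpos_closed R)) => //.
- exact: measurable_itv.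
- by move=> x; rewrite /Rpos /Rpos_closed /= !in_itv/= !andbT; exact: ltW.
- by apply: subspace_continuous_measurable_fun => //; exact: measurable_itv.
Qed.

Lemma ge0_integral_lincomb3 (D : set R) (a b : R) (f1 f2 f3 : R -> R) :
  measurable D -> 0 <= a -> 0 <= b ->
  (forall x, 0 <= f1 x) -> (forall x, 0 <= f2 x) -> (forall x, 0 <= f3 x) ->
  measurable_fun D f1 -> measurable_fun D f2 -> measurable_fun D f3 ->
  (\int[mu]_(x in D) (a * f1 x + b * f2 x + f3 x)%:E =
   a%:E * \int[mu]_(x in D) (f1 x)%:E + b%:E * \int[mu]_(x in D) (f2 x)%:E +
   \int[mu]_(x in D) (f3 x)%:E)%E.
Proof.
move=> mD a0 b0 f10 f20 f30 mf1 mf2 mf3.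
under eq_integral do rewrite !EFinD !EFinM.
have m1 : measurable_fun D (EFin \o f1) by exact/measurable_EFinP.
have m2 : measurable_fun D (EFin \o f2) by exact/measurable_EFinP.
have am1 : measurable_fun D (fun x => (a%:E * (f1 x)%:E)%E).
  by apply/measurable_EFinP; exact: measurable_funM.
have bm2 : measurable_fun D (fun x => (b%:E * (f2 x)%:E)%E).
  by apply/measurable_EFinP; exact: measurable_funM.
have p1 x : (0 <= a%:E * (f1 x)%:E)%E by rewrite mule_ge0// lee_fin.
have p2 x : (0 <= b%:E * (f2 x)%:E)%E by rewrite mule_ge0// lee_fin.
rewrite ge0_integralD//=; last 4 first.
- by move=> x _; rewrite adde_ge0.
- exact: emeasurable_funD.
- by move=> x _; rewrite lee_fin.
- exact/measurable_EFinP.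
rewrite ge0_integralD//= !ge0_integralZl_EFin// => x _; by rewrite lee_fin.
Qed.

Variable phi : R -> R.
Hypothesis phiP : test_function phi.

Lemma is_derive_test_function (x : R) : is_derive x 1 phi (phi^`()%classic x).
Proof.
have [sphi _ _] := phiP; rewrite derive1E; exact/derivableP/(sphi 0%N).
Qed.

Lemma continuous_derive_test_function : continuous (phi^`()%classic).
Proof.
move=> x; have [sphi _ _] := phiP.
by apply: differentiable_continuous; exact/derivable1_diffP/(sphi 1%N x).
Qed.

Lemma continuous_test_function : continuous phi.
Proof. by move=> x; exact: is_derive_continuous (is_derive_test_function x). Qed.

Lemma test_function_0 : phi 0 = 0.
Proof.
have [_ _ supp] := phiP; apply/eqP/negPn/negP => p0.
have /supp : closure [set x | phi x != 0] 0 by apply: subset_closure.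
by rewrite /Rpos /= in_itv/= ltxx.
Qed.

End preliminaries.

(* Elements of H10 have no classical derivative: the estimate for smooth profiles
   is passed to the limit along the approximating test functions. *)
Section H10_stability.
Variables (R : realType) (beta : R) (T g : R -> R) (X e : R).
Notation mu := (@lebesgue_measure R).
Hypothesis hbeta : 0 < beta < pi / 2.
Hypothesis X0 : 0 < X.
Hypothesis Tc : {within Rpos_closed R, continuous T}.
Hypothesis Tg : H10_derivative (fun x => T x - beta) g.
Hypothesis Ie : (\int[mu]_(x in Rpos R)
  (2^-1 * g x ^+ 2 + 2^-1 * sin (T x) ^+ 2)%:E < e%:E)%E.
Hypothesis eX : e < `|cos (T X)|.

Lemma H10_stability : 0 <= cos (T X) /\
  forall x, 0 <= x <= X ->
    cos beta / 2 * (T x - theta0 beta x) ^+ 2 <= e + cos beta - cos (T X).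
Proof.
have [mg [phi [tphi phi' phiT]]] := Tg.
pose Tn n x := phi n x + beta.
pose dTn n : R -> R := (phi n)^`()%classic.
have TnT x : 0 <= x -> Tn n x @[n --> \oo] --> T x.
  move=> x0; rewrite -[X in _ --> X](subrK beta).
  by apply: cvgD; [exact: phiT|exact: cvg_cst].
have dTnP n (x : R) : is_derive x 1 (Tn n) (dTn n x).
  have dphi := is_derive_test_function (tphi n) x.
  by rewrite (_ : Tn n = phi n + cst beta)//; apply: is_derive_eq; rewrite addr0.
have dTnc n : continuous (dTn n) by exact: continuous_derive_test_function.
have Tnc n : continuous (Tn n).
  by move=> x; exact: is_derive_continuous (dTnP n x).
have Tn0 n : Tn n 0 = beta by rewrite /Tn test_function_0// add0r.
pose D := `]0, X]%classic : set R.
have mD : measurable D by exact: measurable_itv.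
have DR : D `<=` Rpos R by apply: subset_itvl.
pose h1 x := 2^-1 * g x ^+ 2 + 2^-1 * sin (T x) ^+ 2.
pose h2 n (x : R) : R := (dTn n x - g x) ^+ 2.
pose h3 n (x : R) : R := `|sin (Tn n x) ^+ 2 - sin (T x) ^+ 2|.
pose L n (x : R) : R := 2^-1 * dTn n x ^+ 2 + 2^-1 * sin (Tn n x) ^+ 2.
have mT : measurable_fun (Rpos R) T by exact: within_Rpos_measurable.
have mTn n : measurable_fun (Rpos R) (Tn n).
  by apply: measurable_funTS; exact: continuous_measurable_fun.
have mdTn n : measurable_fun (Rpos R) (dTn n).
  by apply: measurable_funTS; exact: continuous_measurable_fun.
have mR := @measurable_Rpos R.
have mh1 : measurable_fun (Rpos R) h1.
  by apply: measurable_funD; apply: measurable_funM => //;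
    apply: measurable_funX => //; exact: measurable_sin_comp.
have mh2 n : measurable_fun (Rpos R) (h2 n).
  by apply: measurable_funX => //; exact: measurable_funB.
have mh3 n : measurable_fun (Rpos R) (h3 n).
  apply: measurableT_comp => //; apply: measurable_funB;
    by apply: measurable_funX; exact: measurable_sin_comp.
have mL n : measurable_fun (Rpos R) (L n).
  by apply: measurable_funD; apply: measurable_funM => //;
    apply: measurable_funX => //; exact: measurable_sin_comp.
have h10 x : 0 <= h1 x by rewrite addr_ge0// mulr_ge0// sqr_ge0.
(* Dominated convergence with the constant 1, which is integrable because [D] is bounded. *)
have h3n : (\int[mu]_(x in D) (h3 n x)%:E)%E @[n --> \oo] --> 0%E.
  pose f_ n (x : R) : \bar R := (sin (Tn n x) ^+ 2)%:E.
  pose f (x : R) : \bar R := (sin (T x) ^+ 2)%:E.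
  have mfn n : measurable_fun D (f_ n).
    apply/measurable_EFinP; apply: measurable_funX; apply: measurable_sin_comp.
    exact: measurable_funS (mTn n).
  have mf : measurable_fun D f.
    apply/measurable_EFinP; apply: measurable_funX; apply: measurable_sin_comp.
    exact: measurable_funS mT.
  have f_f : {ae mu, forall x, D x -> f_ ^~ x @ \oo --> f x}.
    apply: aeW => x; rewrite /D /= in_itv/= => /andP[x0 _].
    apply: cvg_EFin; first exact: nearW.
    apply: (@cvg_comp _ _ _ (fun n => sin (Tn n x)) (fun y => y ^+ 2)
      _ (nbhs (sin (T x)))); last exact: exprn_continuous.
    by apply: continuous_cvg; [exact: continuous_sin|exact: TnT (ltW x0)].
  have i1 : mu.-integrable D (cst 1%E).
    by apply: (continuous_integrable_oc (f := cst 1)) => x; exact: cvg_cst.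
  have f_1 : {ae mu, forall x n, D x -> (`|f_ n x| <= cst 1 x)%E}.
    apply: aeW => x k _; rewrite lee_fin normrX -[leRHS](expr1n _ 2).
    by rewrite lerXn2r ?nnegrE// sin_max.
  have [_ + _] := dominated_convergence (mu := mu) mD mfn mf f_f i1 f_1.
  by apply: cvg_trans; apply: near_eq_cvg; apply: nearW => n; exact: eq_integral.
have I0 : (0 <= \int[mu]_(x in Rpos R) (h1 x)%:E)%E.
  by apply: integral_ge0 => x _; rewrite lee_fin.
have [I IE] : exists I, (\int[mu]_(x in Rpos R) (h1 x)%:E = I%:E)%E.
  exists (fine (\int[mu]_(x in Rpos R) (h1 x)%:E)%E); rewrite fineK//.
  by rewrite ge0_fin_numE//; apply: lt_trans Ie _; exact: ltry.
have {}I0 : 0 <= I by rewrite -lee_fin -IE.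
have IltE : I < e by rewrite -lte_fin -IE.
(* The gap [e - I] is cut into quarters: one for [s * I], one for [K] times the error on the
   derivatives, one for the error on the sines, and one to spare. *)
have [s s0 sI] : exists2 s, 0 < s & s * I <= (e - I) / 4.
  by apply: small_factor; lra.
(* Young's inequality [(a + b)^2 <= (1 + s) a^2 + (1 + 1/s) b^2], applied with [a = g] and
   [b = dTn n - g]. *)
pose K := 1 + s^-1.
have K0 : 0 < K by rewrite addr_gt0// invr_gt0.
have LE n : (\int[mu]_(x in `[0%R, X]) (L n x)%:E <= ((1 + s) * I)%:E +
    K%:E * \int[mu]_(x in Rpos R) (h2 n x)%:E + \int[mu]_(x in D) (h3 n x)%:E)%E.
  have m1 : measurable_fun D h1 by exact: measurable_funS mh1.
  have m2 : measurable_fun D (h2 n) by exact: measurable_funS (mh2 n).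
  have m3 : measurable_fun D (h3 n) by exact: measurable_funS (mh3 n).
  have mLD : measurable_fun D (L n) by exact: measurable_funS (mL n).
  rewrite -integral_itv_obnd_cbnd; last exact/measurable_EFinP.
  apply: (@le_trans _ _ (\int[mu]_(x in D)
      ((1 + s) * h1 x + K * h2 n x + h3 n x)%:E)%E).
    apply: ge0_le_integral => //.
    - by move=> x _; rewrite lee_fin addr_ge0// mulr_ge0// sqr_ge0.
    - exact/measurable_EFinP.
    - apply/measurable_EFinP/measurable_funD => //.
      by apply: measurable_funD; exact: measurable_funM.
    - move=> x _; rewrite lee_fin /L /h1 /h2 /h3.
      have hs : sin (Tn n x) ^+ 2 <= sin (T x) ^+ 2 +
          `|sin (Tn n x) ^+ 2 - sin (T x) ^+ 2| by rewrite -lerBlDl ler_norm.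
      have hs' : 0 <= s * sin (T x) ^+ 2 by rewrite mulr_ge0 ?sqr_ge0// ltW.
      have hd : dTn n x ^+ 2 <= (1 + s) * g x ^+ 2 + K * (dTn n x - g x) ^+ 2.
        rewrite -subr_ge0 /K (_ : _ - _ = s^-1 * ((1 + s) * g x - dTn n x) ^+ 2).
          by rewrite mulr_ge0 ?sqr_ge0// invr_ge0 ltW.
        by field; rewrite gt_eqF.
      have hK : 0 <= K * (dTn n x - g x) ^+ 2 by rewrite mulr_ge0 ?sqr_ge0// ltW.
      have := normr_ge0 (sin (Tn n x) ^+ 2 - sin (T x) ^+ 2); lra.
  rewrite ge0_integral_lincomb3//; [|lra|exact: ltW|by move=> x; rewrite /h2 sqr_ge0|by move=> x; rewrite /h3].
  apply: leeD => //; apply: leeD.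
    rewrite EFinM -IE lee_pmul2l// ?lte_fin; last lra.
    apply: ge0_subset_integral => //; first exact/measurable_EFinP.
    by move=> x _; rewrite lee_fin.
  apply: lee_wpmul2l; first by rewrite lee_fin ltW.
  apply: ge0_subset_integral => //; first by apply/measurable_EFinP; exact: mh2.
  by move=> x _; rewrite lee_fin sqr_ge0.
have Lfin n : (\int[mu]_(x in `[0%R, X]) (L n x)%:E)%E \is a fin_num.
  apply: integrable_fin_num => //; apply: continuous_compact_integrable.
    exact: segment_compact.
  apply: continuous_subspaceT => x; apply: cvgD; apply: cvgM; try exact: cvg_cst.
    apply: (@continuous_comp _ _ _ (dTn n) (fun x => x ^+ 2)); first exact: dTnc.
    exact: exprn_continuous.
  apply: (@continuous_comp _ _ _ (sin \o Tn n) (fun x => x ^+ 2)).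
    by apply: continuous_comp; [exact: Tnc|exact: continuous_sin].
  exact: exprn_continuous.
pose en n := fine (\int[mu]_(x in `[0%R, X]) (L n x)%:E)%E.
have enE n : (\int[mu]_(x in `[0%R, X]) (L n x)%:E = (en n)%:E)%E by rewrite fineK.
have en_lt : \forall n \near \oo, en n < e.
  have d1 : 0 < (e - I) / 4 / K by rewrite divr_gt0//; lra.
  have d2 : 0 < (e - I) / 4 by lra.
  near=> n; rewrite -lte_fin -enE; apply: le_lt_trans (LE n) _.
  apply: (@lt_le_trans _ _ ((1 + s) * I + (e - I) / 4 + (e - I) / 4)%:E); last first.
    by rewrite lee_fin; lra.
  rewrite !EFinD lteD//; last by near: n; exact: cvge0_lt.
  rewrite lteD2lE// -lte_pdivlMl// -EFinM mulrC.
  by near: n; exact: cvge0_lt.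
have cosX : cos (Tn n X) @[n --> \oo] --> cos (T X).
  by apply: continuous_cvg; [exact: continuous_cos|exact: TnT (ltW X0)].
have en_gt : \forall n \near \oo, e < `|cos (Tn n X)| by exact: cvgr_norm_gt cosX _ eX.
have st n : en n < e -> e < `|cos (Tn n X)| -> 0 <= cos (Tn n X) /\
    forall x, 0 <= x <= X ->
    cos beta / 2 * (Tn n x - theta0 beta x) ^+ 2 <= e + cos beta - cos (Tn n X).
  move=> h1' h2'; have := @smooth_stability R beta (Tn n) (dTn n) X (en n) hbeta X0
    (dTnP n) (@dTnc n) (Tn0 n) (enE n) (lt_trans h1' h2').
  move=> [? st]; split=> // x xX; apply: le_trans (st x xX) _; lra.
split.
  apply: (cvgr_to_ge cosX); near=> n; apply: (st n _ _).1; by near: n.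
move=> x xX; have /andP[x0 _] := xX.
have lhs : cos beta / 2 * (Tn n x - theta0 beta x) ^+ 2 @[n --> \oo] -->
    cos beta / 2 * (T x - theta0 beta x) ^+ 2.
  apply: cvgM; first exact: cvg_cst.
  apply: (@cvg_comp _ _ _ (fun n => Tn n x - theta0 beta x) (fun y => y ^+ 2)
    _ (nbhs (T x - theta0 beta x))); last exact: exprn_continuous.
  by apply: cvgB; [exact: TnT|exact: cvg_cst].
have rhs : e + cos beta - cos (Tn n X) @[n --> \oo] --> e + cos beta - cos (T X).
  by apply: cvgB; [exact: cvg_cst|exact: cosX].
apply: (ler_cvg_to lhs rhs); near=> n.
by apply: (st n _ _).2 => //; near: n.
Unshelve. all: by end_near. Qed.

End H10_stability.

(** * From bounded intervals to the half-line: minimality and uniqueness *)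

Section energy0_stability.
Variables (R : realType) (beta : R).
Notation mu := (@lebesgue_measure R).
Hypothesis hbeta : 0 < beta < pi / 2.

Lemma deriv_admP (T : R -> R) : admissible beta T ->
  H10_derivative (fun x => T x - beta) (deriv_adm beta T).
Proof. by move=> [_ [g Tg]]; exact: (xgetPex (fun=> 0) (ex_intro _ g Tg)). Qed.

Lemma measurable_deriv_adm (T : R -> R) : admissible beta T ->
  measurable_fun (Rpos R) (deriv_adm beta T).
Proof. by move=> /deriv_admP[]. Qed.

Lemma energy0E (T : R -> R) : admissible beta T ->
  energy0 beta T = (\int[mu]_(x in Rpos R)
    (2^-1 * deriv_adm beta T x ^+ 2 + 2^-1 * sin (T x) ^+ 2)%:E)%E.
Proof.
move=> /[dup]/measurable_deriv_adm mg [/within_Rpos_measurable mT _].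
rewrite /energy0 -ge0_integralZl_EFin//.
- by apply: eq_integral => x _; rewrite -EFinM mulrDr.
- exact: measurable_Rpos.
- by move=> x _; rewrite lee_fin addr_ge0// sqr_ge0.
- apply/measurable_EFinP; apply: measurable_funD; apply: measurable_funX => //.
  exact: measurable_sin_comp.
Qed.

Lemma energy0_fin (T : R -> R) (e : R) : admissible beta T ->
  (energy0 beta T < e%:E)%E -> exists2 E, 0 <= E & energy0 beta T = E%:E.
Proof.
move=> TA Te.
have E0 : (0 <= energy0 beta T)%E.
  by rewrite energy0E//; apply: integral_ge0 => y _;
    rewrite lee_fin addr_ge0// mulr_ge0// sqr_ge0.
have EE : (fine (energy0 beta T))%:E = energy0 beta T.
  by rewrite fineK// ge0_fin_numE//; exact: lt_trans Te (ltry _).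
by exists (fine (energy0 beta T)); rewrite // -lee_fin EE.
Qed.

(** Otherwise [sin^2 >= 1 - m^2] on a whole half-line. The interval []x, b[] is taken just long
    enough to contribute [|e| + 1] to the energy, which exceeds [e]. *)
Lemma cos_near_pm1 (T : R -> R) (m x e : R) : admissible beta T ->
  (energy0 beta T < e%:E)%E -> 0 <= m < 1 -> 0 <= x ->
  exists2 X, x < X & m < `|cos (T X)|.
Proof.
move=> TA Te /andP[m0 m1] x0; apply: contrapT => hX.
have cm X : x < X -> `|cos (T X)| <= m.
  by move=> xX; rewrite leNgt; apply/negP => h; apply: hX; exists X.
have [Tc _] := TA.
have mT := within_Rpos_measurable Tc.
have mg := measurable_deriv_adm TA.
move: Te; rewrite energy0E//; apply/negP; rewrite -leNgt.
pose h X := 2^-1 * deriv_adm beta T X ^+ 2 + 2^-1 * sin (T X) ^+ 2.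
have mh : measurable_fun (Rpos R) h.
  by apply: measurable_funD; apply: measurable_funM => //;
    apply: measurable_funX => //; exact: measurable_sin_comp.
pose k := 2^-1 * (1 - m ^+ 2).
have k0 : 0 < k by rewrite mulr_gt0// subr_gt0 expr_lt1.
have e0 : 0 <= `|e| by [].
pose b := x + (`|e| + 1) / k.
have xb : x < b by rewrite ltrDl divr_gt0//; lra.
have mxb : measurable (`]x, b[%classic : set R) by exact: measurable_itv.
apply: (@le_trans _ _ (\int[mu]_(X in `]x, b[) k%:E)%E).
  rewrite integral_cst_itv// lee_fin /b addrAC subrr add0r mulrC divfK ?gt_eqF//.
  by have := ler_norm e; lra.
have sub : `]x, b[ `<=` Rpos R.
  by move=> y /=; rewrite /Rpos /= !in_itv/= andbT => /andP[xy _]; exact: le_lt_trans xy.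
apply: (@le_trans _ _ (\int[mu]_(X in `]x, b[) (h X)%:E)%E).
  apply: ge0_le_integral => //.
  - by move=> X _; rewrite lee_fin ltW.
  - apply/measurable_EFinP; apply: measurable_funS mh => //.
    exact: measurable_Rpos.
  - move=> X /=; rewrite in_itv/= => /andP[xX _]; rewrite lee_fin /h /k sin2cos2.
    have hc : cos (T X) ^+ 2 <= m ^+ 2.
      by rewrite -(real_normK (num_real _)) lerXn2r ?nnegrE// cm.
    by have := sqr_ge0 (deriv_adm beta T X); lra.
apply: ge0_subset_integral => //.
- exact: measurable_Rpos.
- exact/measurable_EFinP.
- by move=> X _; rewrite lee_fin addr_ge0// mulr_ge0// sqr_ge0.
Qed.

Lemma energy0_stability (T : R -> R) (e x : R) : admissible beta T ->
  (energy0 beta T < e%:E)%E -> e <= 1 -> 0 <= x ->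
  cos beta / 2 * (T x - theta0 beta x) ^+ 2 <= e + cos beta - 1.
Proof.
move=> TA Te e1 x0.
have [Tc _] := TA.
have [E E0 EE] := energy0_fin TA Te.
move: Te; rewrite EE lte_fin => Ee.
pose e' := (E + e) / 2.
(* Half of the slack between [E] and [e] makes the energy bound strict; the other half pays for
   [1 - |cos (T X)|]. The bound [e <= 1] keeps [m] below 1. *)
have [Ee' e'e] : E < e' /\ e' < e by rewrite /e'; split; lra.
pose m := Num.max e' (1 - (e - e')).
have [X xX mX] : exists2 X, x < X & m < `|cos (T X)|.
  apply: (@cos_near_pm1 _ _ _ e) => //; first by rewrite EE lte_fin.
  rewrite /m le_max gt_max; apply/andP; split; first by apply/orP; left; lra.
  by apply/andP; split; lra.
have [e'X X1] : e' < `|cos (T X)| /\ 1 - (e - e') < `|cos (T X)|.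
  by move: mX; rewrite gt_max => /andP[].
have X0 : 0 < X by exact: le_lt_trans xX.
have [] := H10_stability (e := e') hbeta X0 Tc (deriv_admP TA) _ e'X.
  by rewrite -energy0E// EE lte_fin.
move=> cX /(_ x); rewrite x0 (ltW xX) => /(_ isT) st.
by move: X1; rewrite ger0_norm//; lra.
Qed.

(** A smaller energy would make the right-hand side of the stability estimate negative, which is
    already absurd at the point 0. *)
Lemma energy0_ge (T : R -> R) : admissible beta T ->
  ((1 - cos beta)%:E <= energy0 beta T)%E.
Proof.
move=> TA; rewrite leNgt; apply/negP => Tlt.
have /andP[b0 bp] := hbeta; have p0 := @pi_gt0 R.
have cb0 : 0 < cos beta by rewrite cos_gt0_pihalf//; lra.
have [E E0 EE] := energy0_fin TA Tlt.
move: Tlt; rewrite EE lte_fin => Elt.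
have := @energy0_stability T ((E + (1 - cos beta)) / 2) 0 TA.
rewrite EE lte_fin => /(_ ltac:(lra) ltac:(lra) (lexx _)).
have : 0 <= cos beta / 2 * (T 0 - theta0 beta 0) ^+ 2.
  by rewrite mulr_ge0 ?sqr_ge0//; lra.
lra.
Qed.

Lemma energy0_eq (T : R -> R) : admissible beta T ->
  (energy0 beta T <= (1 - cos beta)%:E)%E ->
  forall x, 0 <= x -> T x = theta0 beta x.
Proof.
move=> TA Tle x x0.
have /andP[b0 bp] := hbeta; have p0 := @pi_gt0 R.
have cb0 : 0 < cos beta by rewrite cos_gt0_pihalf//; lra.
suff D0 : (T x - theta0 beta x) ^+ 2 <= 0.
  apply/eqP; rewrite -subr_eq0 -sqrf_eq0 eq_le D0; exact: sqr_ge0.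
rewrite -(pmulr_rle0 _ (_ : 0 < cos beta / 2)); last lra.
apply/ler_addgt0Pr => eps eps0; rewrite add0r.
(* The cap at [cos beta] keeps the energy level [1 - cos beta + min eps (cos beta)] at most 1, as
   the stability estimate requires. *)
have h : 0 < Num.min eps (cos beta) by rewrite lt_min eps0.
have := @energy0_stability T (1 - cos beta + Num.min eps (cos beta)) x TA.
move=> /(_ _ _ x0); rewrite (le_lt_trans Tle) ?lte_fin; last lra.
have h1 : Num.min eps (cos beta) <= cos beta by rewrite ge_min lexx orbT.
have h2 : Num.min eps (cos beta) <= eps by rewrite ge_min lexx.
move=> /(_ isT ltac:(lra)); lra.
Qed.

End energy0_stability.

(** * Uniqueness of the derivative *)

Section H10_derivative_unique.
Variables (R : realType) (u g : R -> R).
Notation mu := (@lebesgue_measure R).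
Hypothesis ug : H10_derivative u g.

(** On a bounded interval convergence in [L^2] gives convergence in [L^1], so the identity between
    [phi n X] and the integral of its derivative passes to the limit. *)
Lemma H10_derivative_integral (X : R) : 0 < X ->
  mu.-integrable `]0, X] (EFin \o g) /\
  (\int[mu]_(x in `]0%R, X]) (g x)%:E = (u X)%:E)%E.
Proof.
move=> X0; have [mg [phi [tphi phi' phiu]]] := ug.
pose dphi n : R -> R := (phi n)^`()%classic.
pose D := `]0, X]%classic : set R.
have mD : measurable D by exact: measurable_itv.
have mR := @measurable_Rpos R.
have DR : D `<=` Rpos R by apply: subset_itvl.
have dphic n : continuous (dphi n) by exact: continuous_derive_test_function.
have mdphi n : measurable_fun (Rpos R) (dphi n).
  by apply: measurable_funTS; exact: continuous_measurable_fun.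
have mb n : measurable_fun (Rpos R) (fun x => dphi n x - g x).
  exact: measurable_funB.
have mb2 n : measurable_fun (Rpos R) (fun x => (dphi n x - g x) ^+ 2).
  exact: measurable_funX.
have idphi n : mu.-integrable D (EFin \o dphi n).
  exact: continuous_integrable_oc.
(* The pointwise bound [b <= s + b^2 / s] serves as a Cauchy-Schwarz inequality once [s] is of order
   [eps / X]. The summand [0 * 0] below only fits the three-term shape of
   [ge0_integral_lincomb3]. *)
have pow n s : 0 < s -> (\int[mu]_(x in D) (`|dphi n x - g x|)%:E <=
    (s * X)%:E + s^-1%:E * \int[mu]_(x in Rpos R) ((dphi n x - g x) ^+ 2)%:E)%E.
  move=> s0.
  apply: (@le_trans _ _ (\int[mu]_(x in D)
      (0 * 0 + s^-1 * (dphi n x - g x) ^+ 2 + s)%:E)%E).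
    apply: ge0_le_integral => //.
    - apply/measurable_EFinP; apply: measurableT_comp => //.
      by apply: measurable_funS (mb n).
    - apply/measurable_EFinP; apply: measurable_funD => //.
      apply: measurable_funD => //; apply: measurable_funM => //.
      by apply: measurable_funS (mb2 n).
    - move=> x _; rewrite lee_fin mul0r add0r.
      have := sqr_ge0 (`|dphi n x - g x| - s / 2).
      rewrite -[X in s^-1 * X]real_normK ?num_real//.
      move: `|_| (normr_ge0 (dphi n x - g x)) => b b0 h.
      rewrite -subr_ge0 (_ : _ - _ = s^-1 * ((b - s / 2) ^+ 2 + 3 / 4 * s ^+ 2)).
        apply: mulr_ge0; first by rewrite invr_ge0 ltW.
        by have := sqr_ge0 (b - s / 2); have := sqr_ge0 s; lra.
      by field; rewrite gt_eqF.
  rewrite (ge0_integral_lincomb3 (f1 := cst 0) (f3 := cst s))//.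
  - rewrite mul0e add0e addeC; apply: leeD.
      by rewrite integral_cst_itv// subr0.
    apply: lee_wpmul2l; first by rewrite lee_fin invr_ge0 ltW.
    apply: ge0_subset_integral => //; first by apply/measurable_EFinP; exact: mb2.
    by move=> x _; rewrite lee_fin sqr_ge0.
  - by rewrite invr_ge0 ltW.
  - by move=> x; rewrite sqr_ge0.
  - by move=> x; rewrite ltW.
  - exact: measurable_funS (mb2 n).
have small eps : 0 < eps -> \forall n \near \oo,
    (\int[mu]_(x in D) (`|dphi n x - g x|)%:E < eps%:E)%E.
  move=> eps0; pose s := eps / 2 / X.
  have s0 : 0 < s by rewrite !divr_gt0.
  have d0 : 0 < s * (eps / 2) by rewrite mulr_gt0// divr_gt0.
  near=> n; apply: le_lt_trans (pow n s s0) _.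
  have -> : s * X = eps / 2 by rewrite /s divfK ?gt_eqF.
  rewrite [ltRHS](_ : _ = ((eps / 2)%:E + (eps / 2)%:E)%E); last first.
    by rewrite -EFinD; congr EFin; lra.
  rewrite lteD2lE// muleC lte_pdivrMr// -EFinM mulrC.
  by near: n; exact: cvge0_lt.
have mDb n : measurable_fun D (fun x => dphi n x - g x).
  exact: measurable_funS (mb n).
have ib n : (\int[mu]_(x in D) (`|dphi n x - g x|)%:E < 1%:E)%E ->
    mu.-integrable D (EFin \o (fun x => dphi n x - g x)).
  move=> lt1; apply/integrableP; split; first by apply/measurable_EFinP; exact: mDb.
  exact: lt_trans lt1 (ltry _).
have [N _ N1] := small 1 ltr01.
have ig : mu.-integrable D (EFin \o g).
  have := integrableB (mu := mu) mD (idphi N) (ib N (N1 N (leqnn N))).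
  apply: eq_integrable => // x _.
  by rewrite /= -EFinB opprB addrC subrK.
split=> //.
pose G := fine (\int[mu]_(x in D) (g x)%:E)%E.
have GE : (\int[mu]_(x in D) (g x)%:E = G%:E)%E.
  by rewrite fineK//; exact: integrable_fin_num.
have phiX n : (\int[mu]_(x in D) (dphi n x)%:E = (phi n X)%:E)%E.
  rewrite /D integral_itv_obnd_cbnd; last first.
    apply/measurable_EFinP; apply: measurable_funTS.
    exact: continuous_measurable_fun.
  have phic : continuous (phi n) by exact: continuous_test_function.
  rewrite (continuous_FTC2 (F := phi n))//.
  - by rewrite test_function_0// sube0.
  - exact: continuous_subspaceT.
  - split.
    + by move=> x _; have [] := is_derive_test_function (tphi n) x.
    + by apply: cvg_at_right_filter; exact: phic.
    + by apply: cvg_at_left_filter; exact: phic.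
rewrite GE; congr EFin.
have X0' : 0 <= X by exact: ltW.
apply: (cvg_unique _ _ (phiu X X0')) => //.
apply/cvgrPdist_lt => eps eps0; near=> n.
rewrite -lte_fin.
apply: (@le_lt_trans _ _ (\int[mu]_(x in D) (`|dphi n x - g x|)%:E)%E); last first.
  by near: n; exact: small.
have n1 : (\int[mu]_(x in D) (`|dphi n x - g x|)%:E < 1%:E)%E.
  by near: n; exact: small.
rewrite distrC -[(`|_|)%:E]/(`|(phi n X - G)%:E|)%E EFinB -phiX -GE.
have mbn : measurable_fun D (EFin \o (fun x => dphi n x - g x)).
  by apply/measurable_EFinP; exact: mDb.
by have := le_abse_integral mu mD mbn; rewrite integralB_EFin.
Unshelve. all: by end_near. Qed.

(** Lebesgue differentiation of the integral of [g] over []0, y]], which is [u y]. Extending [g] by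
    zero makes it locally integrable on the whole line. This ties the chosen representative of the
    derivative to the classical one. *)
Lemma H10_derivative_ae (du : R -> R) :
  (forall x : R, 0 < x -> is_derive x 1 u (du x)) ->
  {ae mu, forall x, Rpos R x -> g x = du x}.
Proof.
move=> udu; have mR := @measurable_Rpos R; have [mg _] := ug.
pose f := g \_ (Rpos R).
have mf : measurable_fun setT f by apply/(measurable_restrictT _ mR).
have fg (y : R) : 0 < y -> f y = g y.
  by move=> y0; rewrite /f patchE mem_set// /Rpos /= in_itv/= y0.
have fi (y : R) : mu.-integrable `]0, y] (EFin \o f).
  pose z := Num.max y 1.
  have z0 : 0 < z by rewrite lt_max ltr01 orbT.
  have [gi _] := H10_derivative_integral z0.
  have fiz : mu.-integrable `]0, z] (EFin \o f).
    apply: eq_integrable gi => // x; rewrite inE/= in_itv/= => /andP[x0 _].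
    by rewrite fg.
  apply: integrableS fiz => //; apply: subset_itvl.
  by rewrite bnd_simp le_max lexx.
have floc : locally_integrable setT f.
  split=> //; first exact: openT.
  move=> K _ /[dup]cK /compact_bounded[M [Mreal KM]].
  have mK : measurable K by exact: (compact_measurable cK).
  pose y := `|M| + 1.
  have Ky : K `<=` `]-oo, y].
    move=> x Kx; rewrite /= in_itv/=; apply: le_trans (ler_norm x) _.
    by apply: KM Kx; rewrite /y; have := ler_norm M; lra.
  have y0 : 0 < y by rewrite /y; have := normr_ge0 M; lra.
  have mn : measurable_fun setT (fun x => `|f x|%:E).
    by apply/measurable_EFinP; apply: measurableT_comp.
  have /integrableP[_] := fi y; apply: le_lt_trans.
  rewrite integral_mkcond [leRHS]integral_mkcond.
  have my : measurable (`]0, y]%classic : set R) by exact: measurable_itv.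
  apply: ge0_le_integral => //.
  - by move=> x _; rewrite patchE; case: ifPn.
  - by apply/(measurable_restrictT _ mK); apply: measurable_funTS; exact: mn.
  - by apply/(measurable_restrictT _ my); apply: measurable_funTS; exact: mn.
  - move=> x _; rewrite !patchE; case: ifPn => [/set_mem Kx|_]; last first.
      by case: ifPn => _; [exact: abse_ge0|exact: lexx].
    case: ifPn => //; rewrite notin_setE /= in_itv/= => /negP.
    rewrite negb_and -!leNgt -ltNge => /orP[x0|yx].
      rewrite /= (_ : f x = 0) ?normr0; first exact: lexx.
      rewrite /f patchE memNset// /Rpos /= in_itv/= andbT.
      by apply/negP; rewrite -leNgt.
    by have := Ky _ Kx; rewrite /= in_itv/= leNgt yx.
have := FTC1 fi floc; apply: filterS; first exact: (ae_filter_ringOfSetsType mu).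
move=> x h; rewrite /Rpos /= in_itv/= andbT => x0.
have [|_] := h _; first by rewrite lte_fin.
rewrite fg// => <-.
have [_ <-] := udu _ x0; rewrite derive1E; apply: near_eq_derive.
near=> y.
have y0 : 0 < y by near: y; exact: lt_nbhsr.
rewrite /Rintegral -[RHS]/(fine (u y)%:E); congr fine.
have [_ <-] := H10_derivative_integral y0.
by apply: eq_integral => z; rewrite inE/= in_itv/= => /andP[z0 _]; rewrite fg.
Unshelve. all: by end_near. Qed.

End H10_derivative_unique.

(** * Decay and energy of [theta0] *)

Section decay.
Variable R : realType.
Notation mu := (@lebesgue_measure R).

Lemma sin_lipschitz (a b : R) : `|sin a - sin b| <= `|a - b|.
Proof.
wlog ba : a b / b <= a.
  by move=> h; have [/h//|/ltW/h] := leP b a; rewrite distrC (distrC a).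
rewrite [leRHS]ger0_norm ?subr_ge0// -[leRHS]mul1r.
apply: (@MVT_lipschitz R sin cos 1 b a ba).
- by apply: continuous_subspaceT => y; exact: continuous_sin.
- by move=> x _; exact: cos_max.
Qed.

Lemma sin_le_norm (a : R) : `|sin a| <= `|a|.
Proof. by have := sin_lipschitz a 0; rewrite sin0 !subr0. Qed.

Lemma atan_le (s : R) : 0 <= s -> atan s <= s.
Proof.
move=> s0; apply: le_trans (ler_norm _) _.
have := @MVT_lipschitz R atan (fun x => (1 + x ^+ 2)^-1) 1 0 s s0.
rewrite atan0 !subr0 mul1r; apply.
- by apply: continuous_subspaceT => y; exact: continuous_atan.
- move=> x _; by rewrite ger0_norm ?invr_ge0 -/(oneDsqr x)// ?invf_le1// (le_trans ler01)// oneDsqr_ge1.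
Qed.

(** From [exp x >= (1 + x/2)^2] and [4 (1 + x/2)^2 >= 1 + x^2]. Exponential decay is traded for a
    weight whose integral is explicit. *)
Lemma expRN_le (x : R) : 0 <= x -> expR (- x) <= 4 * (oneDsqr x)^-1.
Proof.
move=> x0; have o1 := oneDsqr_ge1 x.
rewrite expRN ler_pdivlMr; last lra.
rewrite mulrC ler_pdivrMr ?expR_gt0//.
have -> : expR x = expR (x / 2) ^+ 2 by rewrite -expRM_natl; congr expR; field.
have h := expR_ge1Dx (x / 2).
have h2 : (1 + x / 2) ^+ 2 <= expR (x / 2) ^+ 2.
  by rewrite lerXn2r ?nnegrE ?expR_ge0//; lra.
by move: h2; rewrite /oneDsqr; lra.
Qed.

Lemma oneDsqrV_gt0 (x : R) : 0 < (oneDsqr x)^-1.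
Proof. by rewrite invr_gt0 (lt_le_trans ltr01)// oneDsqr_ge1. Qed.

Lemma oneDsqrVK (x : R) : (oneDsqr x)^-1 * (1 + x ^+ 2) = 1.
Proof. by rewrite mulVf// gt_eqF// (lt_le_trans ltr01)// oneDsqr_ge1. Qed.

Lemma measurable_oneDsqrV : measurable_fun (Rpos R) (fun x : R => (oneDsqr x)^-1).
Proof.
apply: measurable_funTS; apply: continuous_measurable_fun.
exact: continuous_oneDsqrV.
Qed.

Lemma integral_oneDsqrV :
  (\int[mu]_(x in Rpos R) ((oneDsqr x)^-1)%:E = (pi / 2)%:E)%E.
Proof.
rewrite /Rpos integral_itv_obnd_cbnd ?integral0y_oneDsqr//.
by apply/measurable_EFinP; exact: measurable_oneDsqrV.
Qed.

Lemma integrable_oneDsqrV : mu.-integrable (Rpos R) (fun x => ((oneDsqr x)^-1)%:E).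
Proof.
apply/integrableP; split.
  by apply/measurable_EFinP; exact: measurable_oneDsqrV.
under eq_integral => x _ do rewrite gee0_abs ?lee_fin ?ltW ?oneDsqrV_gt0//.
by rewrite integral_oneDsqrV ltry.
Qed.

Variable beta : R.
Hypothesis hbeta : 0 < beta < pi / 2.

Lemma theta0_le_expR (x : R) : theta0 beta x <= 2 * expR (- x).
Proof.
have p0 := @pi_gt0 R; have /andP[b0 bp] := hbeta.
rewrite /theta0 ler_pM2l//.
have t0 : 0 < tan (beta / 2).
  by rewrite -tan0 ltr_tan ?in_itv/=; lra.
have t1 : tan (beta / 2) < 1.
  by rewrite -[ltRHS]tan_piquarter ltr_tan ?in_itv/=; lra.
have e0 := expR_gt0 (- x).
apply: le_trans (atan_le _) _; first by rewrite ltW// mulr_gt0.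
by rewrite ler_piMr// ltW.
Qed.

Lemma theta0_le_oneDsqrV (x : R) : 0 <= x -> theta0 beta x <= 8 * (oneDsqr x)^-1.
Proof. by move=> x0; have := theta0_le_expR x; have := expRN_le x0; lra. Qed.

Lemma cvg_theta0 : theta0 beta x @[x --> +oo] --> 0.
Proof.
apply: (@squeeze_cvgr _ _ _ _ (cst 0) (fun x => 2 * expR (- x))).
- by apply: nearW => x; rewrite /= ltW ?theta0_gt0//= theta0_le_expR.
- exact: cvg_cst.
- by rewrite -[X in _ --> X](mulr0 2); apply: cvgMr; exact: cvgr_expR.
Qed.

(** Since [theta0' = - sin theta0], the function [cos theta0] is a primitive of the integrand; it
    runs from [cos beta] to 1. *)
Lemma integral_sin2_theta0 :
  (\int[mu]_(x in Rpos R) (sin (theta0 beta x) ^+ 2)%:E = (1 - cos beta)%:E)%E.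
Proof.
have sc : continuous (fun x => sin (theta0 beta x) ^+ 2).
  move=> x; apply: (@continuous_comp _ _ _ (sin \o theta0 beta) (fun x => x ^+ 2)).
    by apply: continuous_comp; [exact: continuous_theta0|exact: continuous_sin].
  exact: exprn_continuous.
have dF (x : R) : is_derive x 1 (cos \o theta0 beta) (sin (theta0 beta x) ^+ 2).
  by have dt := is_derive_theta0 beta x; apply: is_derive_eq; ring.
rewrite /Rpos integral_itv_obnd_cbnd; last first.
  by apply/measurable_EFinP; apply: measurable_funTS; exact: continuous_measurable_fun.
rewrite (@ge0_continuous_FTC2y _ _ (cos \o theta0 beta) 0 1).
- by rewrite /= theta0_0// EFinB.
- by move=> x _; exact: sqr_ge0.
- exact: continuous_subspaceT.
- rewrite -[X in _ --> X]cos0; apply: continuous_cvg; first exact: continuous_cos.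
  exact: cvg_theta0.
- by move=> x _; have [] := dF x.
- by apply: cvg_at_right_filter; exact: is_derive_continuous (dF 0).
- by move=> x _; rewrite derive1E; have [_ ->] := dF x.
Qed.

Lemma deriv_adm_theta0_ae : admissible beta (theta0 beta) ->
  {ae mu, forall x, Rpos R x ->
    deriv_adm beta (theta0 beta) x = - sin (theta0 beta x)}.
Proof.
move=> /deriv_admP h; apply: (H10_derivative_ae h) => x _.
have dt := is_derive_theta0 beta x.
rewrite (_ : (fun y => _) = theta0 beta - cst beta)//.
by apply: is_derive_eq; rewrite subr0.
Qed.

(** Equipartition: almost everywhere [theta0'^2 = sin^2 theta0], so the energy density reduces to
    [sin^2 theta0]. *)
Lemma energy0_theta0 : admissible beta (theta0 beta) ->
  energy0 beta (theta0 beta) = (1 - cos beta)%:E.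
Proof.
move=> TA; rewrite energy0E// -integral_sin2_theta0.
have mg := measurable_deriv_adm TA; have [Tc _] := TA.
have ms : measurable_fun (Rpos R) (fun x => sin (theta0 beta x) ^+ 2).
  by apply: measurable_funX; apply: measurable_sin_comp; exact: within_Rpos_measurable.
apply: ae_eq_integral.
- exact: measurable_Rpos.
- apply/measurable_EFinP; apply: measurable_funD; apply: measurable_funM => //.
  exact: measurable_funX.
- exact/measurable_EFinP.
- have := deriv_adm_theta0_ae TA; apply: filterS.
    exact: (ae_filter_ringOfSetsType mu).
  by move=> x h /h ->; congr EFin; rewrite sqrrN; lra.
Qed.

End decay.

(** * Admissibility of [theta0] *)

(* The test functions below are smooth because they belong to an algebra of
   functions that is stable under derivation. *)
Section differential_algebra.
Variables (R : realType) (G : set (R -> R)).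

Inductive diff_alg : (R -> R) -> Prop :=
| diff_alg_gen f : G f -> diff_alg f
| diff_alg_cst c : diff_alg (cst c)
| diff_alg_add f g : diff_alg f -> diff_alg g -> diff_alg (f + g)
| diff_alg_mul f g : diff_alg f -> diff_alg g -> diff_alg (f * g).

Hypothesis G_derive : forall f, G f -> exists2 df, diff_alg df &
  forall x : R, is_derive x 1 f (df x).

Lemma diff_alg_derive f : diff_alg f -> exists2 df, diff_alg df &
  forall x : R, is_derive x 1 f (df x).
Proof.
elim=> {f} [f /G_derive//|c|f g _ [df fA dfP] _ [dg gA dgP]|
            f g fA [df dfA dfP] gA [dg dgA dgP]].
- by exists (cst 0); [exact: diff_alg_cst|move=> x; exact: is_derive_cst].
- exists (df + dg); first exact: diff_alg_add.
  by move=> x; have := dfP x; have := dgP x; move=> ? ?; exact: is_deriveD.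
- exists (f * dg + g * df).
    by apply: diff_alg_add; exact: diff_alg_mul.
  by move=> x; have := dfP x; have := dgP x; move=> ? ?; exact: is_deriveM.
Qed.

Lemma diff_alg_smooth f : diff_alg f -> smooth f.
Proof.
move=> fA n; suff /diff_alg_derive[df _ dfP] : diff_alg (derive1n n f).
  by move=> x; have [] := dfP x.
elim: n => [//|n /diff_alg_derive[df dfA dfP]].
rewrite (_ : derive1n n.+1 f = df)//; apply/funext => x.
by rewrite derive1nS derive1E; have [_ ->] := dfP x.
Qed.

End differential_algebra.

Lemma is_derive_affine (R : realType) (f : R -> R) (df a b x : R) :
  is_derive (a * x + b) 1 f df -> is_derive x 1 (fun y => f (a * y + b)) (a * df).
Proof.
move=> fd.
rewrite (_ : (fun y => f (a * y + b)) = f \o (a \*: id + cst b))//.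
have h : is_derive x 1 (a \*: (id : R -> R) + cst b) a.
  by apply: is_derive_eq; rewrite addr0 /GRing.scale /= mulr1.
by rewrite mulrC; exact: is_derive1_comp.
Qed.

(** * Approximation of the profile by test functions *)

Section cutoff.
Variables (R : realType) (beta : R) (eta : R -> R).
Hypothesis hbeta : 0 < beta < pi / 2.
Hypothesis heta : cutoff beta eta.
Let deta : R -> R := eta^`()%classic.

Lemma is_derive_cutoff (x : R) : is_derive x 1 eta (deta x).
Proof. by have [se _ _ _ _] := heta; rewrite /deta derive1E; exact/derivableP/(se 0%N). Qed.

Lemma derive_cutoff_eq0 (x : R) : x < 0 \/ 1 < x -> deta x = 0.
Proof.
have [_ _ e0 e1 _] := heta; rewrite /deta derive1E => -[x0|x1].
  rewrite (@near_eq_derive _ _ _ eta (cst beta)) ?derive_cst//.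
  near=> y; apply: e0; apply: ltW; near: y; exact: lt_nbhsl.
rewrite (@near_eq_derive _ _ _ eta (cst 0)) ?derive_cst//.
near=> y; apply: e1; apply: ltW; near: y; exact: lt_nbhsr.
Unshelve. all: by end_near. Qed.

Lemma derive_cutoff_bounded : exists2 M, 0 < M & forall x, `|deta x| <= M.
Proof.
have dc : continuous deta.
  move=> x; have [se _ _ _ _] := heta.
  by apply: differentiable_continuous; exact/derivable1_diffP/(se 1%N x).
have nc : {within `[0, 1], continuous (fun x => `|deta x|)}.
  apply: continuous_subspaceT => x.
  by apply: continuous_comp; [exact: dc|exact: norm_continuous].
have [c _ cM] := EVT_max ler01 nc.
have c0 := normr_ge0 (deta c).
exists (`|deta c| + 1); first lra.
move=> x; have [x0|x0] := ltP x 0.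
  by rewrite derive_cutoff_eq0 ?normr0; [lra|left].
have [x1|x1] := ltP 1 x.
  by rewrite derive_cutoff_eq0 ?normr0; [lra|right].
by have := cM x; rewrite in_itv/= x0 x1 => /(_ isT); lra.
Qed.

(** The cutoff of the energy, rescaled, also serves as a bump function. With [N = n + 1], the first
    factor in [eta] is 1 up to [N] and 0 from [2 N] on; the second is 0 up to [1 / N] and 1 from
    [2 / N] on. The additions of negated constants match the form [a * x + b] of
    [is_derive_affine]. *)
Definition theta0_test (n : nat) (x : R) : R :=
  (theta0 beta x - beta) * (beta^-1 * eta (n.+1%:R^-1 * x + -1)) *
  (1 + - beta^-1 * eta (n.+1%:R * x + -1)).

Definition dtheta0_test (n : nat) (x : R) : R :=
  - sin (theta0 beta x) * (beta^-1 * eta (n.+1%:R^-1 * x + -1)) *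
    (1 + - beta^-1 * eta (n.+1%:R * x + -1)) +
  (theta0 beta x - beta) *
    (beta^-1 * (n.+1%:R^-1 * deta (n.+1%:R^-1 * x + -1)) *
     (1 + - beta^-1 * eta (n.+1%:R * x + -1)) +
     beta^-1 * eta (n.+1%:R^-1 * x + -1) *
     (- beta^-1 * (n.+1%:R * deta (n.+1%:R * x + -1)))).

Lemma is_derive_theta0_test n (x : R) :
  is_derive x 1 (theta0_test n) (dtheta0_test n x).
Proof.
pose N : R := n.+1%:R.
have dt := is_derive_theta0 beta x.
have d1 := is_derive_affine (is_derive_cutoff (N^-1 * x + -1)).
have d2 := is_derive_affine (is_derive_cutoff (N * x + -1)).
rewrite (_ : theta0_test n = (theta0 beta - cst beta) *
  (beta^-1 \*: (fun x => eta (N^-1 * x + -1))) *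
  (cst 1 + - beta^-1 \*: (fun x => eta (N * x + -1))))//.
apply: is_derive_eq.
by rewrite /dtheta0_test !fctE /= /GRing.scale /= -/N; ring.
Qed.

(** The generators are [theta0], its sine and cosine, and all derivatives of [eta] under affine
    changes of variable. The equation [theta0' = - sin theta0] closes the algebra they generate
    under derivation. *)
Lemma smooth_theta0_test n : smooth (theta0_test n).
Proof.
pose G := [set f : R -> R | [\/ f = theta0 beta, f = sin \o theta0 beta,
  f = cos \o theta0 beta |
  exists k a b, f = fun x => derive1n k eta (a * x + b)]].
have Gt : diff_alg G (theta0 beta) by apply: diff_alg_gen; constructor 1.
have Gs : diff_alg G (sin \o theta0 beta) by apply: diff_alg_gen; constructor 2.
have Gc : diff_alg G (cos \o theta0 beta) by apply: diff_alg_gen; constructor 3.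
have Ge k a b : diff_alg G (fun x => derive1n k eta (a * x + b)).
  by apply: diff_alg_gen; constructor 4; exists k, a, b.
have GZ c f : diff_alg G f -> diff_alg G (fun x => c * f x).
  by move=> fA; exact: (diff_alg_mul (diff_alg_cst _ c) fA).
apply: (@diff_alg_smooth R G).
  move=> f [->|->|->|[k [a [b ->]]]].
  - exists (fun x => -1 * (sin \o theta0 beta) x); first exact: GZ.
    by move=> x; have := is_derive_theta0 beta x; rewrite mulN1r.
  - exists ((fun x => -1 * (sin \o theta0 beta) x) * (cos \o theta0 beta)).
      by apply: diff_alg_mul => //; exact: GZ.
    move=> x; have dt := is_derive_theta0 beta x.
    by apply: is_derive_eq; rewrite fctE/=; ring.
  - exists ((sin \o theta0 beta) * (sin \o theta0 beta)); first exact: diff_alg_mul.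
    move=> x; have dt := is_derive_theta0 beta x.
    by apply: is_derive_eq; rewrite fctE/=; ring.
  - exists (fun x => a * derive1n k.+1 eta (a * x + b)).
      by apply: (GZ a (fun x => derive1n k.+1 eta (a * x + b))); exact: Ge.
    move=> x; apply: is_derive_affine; rewrite derive1nS derive1E.
    by have [se _ _ _ _] := heta; exact/derivableP/se.
rewrite (_ : theta0_test n = (theta0 beta + cst (- beta)) *
  (fun x => beta^-1 * derive1n 0 eta (n.+1%:R^-1 * x + -1)) *
  (cst 1 + (fun x => - beta^-1 * derive1n 0 eta (n.+1%:R * x + -1))))//.
apply: diff_alg_mul; first apply: diff_alg_mul.
- by apply: diff_alg_add => //; exact: diff_alg_cst.
- exact: (GZ _ (fun x => derive1n 0 eta (n.+1%:R^-1 * x + -1)) (Ge _ _ _)).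
- apply: diff_alg_add; first exact: diff_alg_cst.
  exact: (GZ _ (fun x => derive1n 0 eta (n.+1%:R * x + -1)) (Ge _ _ _)).
Qed.

Lemma test_function_theta0_test n : test_function (theta0_test n).
Proof.
have /andP[b0 _] := hbeta; have [_ _ e0 e1 _] := heta.
have N0 : 0 < n.+1%:R :> R by rewrite ltr0n.
pose K := `[n.+1%:R^-1, 2 * n.+1%:R]%classic : set R.
have suppK : closure [set x | theta0_test n x != 0] `<=` K.
  rewrite closureE => x; apply; split; first exact: interval_closed.
  move=> y y0; rewrite /K /= in_itv/=; move: y0; apply: contraNT; rewrite negb_and -!ltNge.
  move=> /orP[yn|yn]; apply/eqP; rewrite /theta0_test.
    rewrite [X in _ * (1 + - beta^-1 * X)]e0; last first.
      by rewrite subr_le0 -ler_pdivlMl// mulr1 ltW.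
    by rewrite mulNr mulVf ?gt_eqF// subrr mulr0.
  rewrite [X in _ * (beta^-1 * X)]e1 ?mulr0 ?mul0r//.
  by rewrite lerBrDr -ler_pdivrMl// invrK mulrC ltW.
split; first exact: smooth_theta0_test.
- apply: subclosed_compact suppK; first exact: closed_closure.
  exact: segment_compact.
- move=> x /suppK; rewrite /K /Rpos /= !in_itv/= andbT => /andP[+ _].
  by apply: lt_le_trans; rewrite invr_gt0.
Qed.

(** A fixed [x > 0] ends up strictly between [2 / N] and [N], where both cutoff factors are locally
    constant; pointwise convergence is thus stationary. *)
Lemma theta0_test_eventually (x : R) : 0 < x -> \forall n \near \oo,
  theta0_test n x = theta0 beta x - beta /\
  dtheta0_test n x = - sin (theta0 beta x).
Proof.
move=> x0; have /andP[b0 _] := hbeta; have [_ _ e0 e1 _] := heta.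
near=> n; pose N : R := n.+1%:R.
have nN : n%:R < N by rewrite ltr_nat.
have xN : N^-1 * x + -1 < 0.
  rewrite subr_lt0 ltr_pdivrMl ?ltr0n// mulr1; apply: lt_trans nN.
  by near: n; exact: nbhs_infty_gtr.
have Nx : 1 < N * x + -1.
  rewrite ltrBrDr -ltr_pdivrMr//; apply: lt_trans nN.
  by near: n; exact: nbhs_infty_gtr.
rewrite /theta0_test /dtheta0_test -/N e0 ?(ltW xN)// e1 ?(ltW Nx)//.
rewrite !derive_cutoff_eq0; [|by right|by left].
by rewrite mulVf ?gt_eqF//; split; ring.
Unshelve. all: by end_near. Qed.

(** The slope [sin theta0] is at most [theta0], which is nonincreasing: the Lipschitz constant
    beyond [x] decays with [x]. At [x = 0] this gives the linear bound [beta * y] near the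
    boundary. *)
Lemma theta0_lipschitz (x y : R) : 0 <= x <= y ->
  `|theta0 beta y - theta0 beta x| <= theta0 beta x * (y - x).
Proof.
move=> /andP[x0 xy].
apply: (@MVT_lipschitz R (theta0 beta) (fun x => - sin (theta0 beta x))) => //.
- by move=> z _; exact: is_derive_theta0.
- by apply: continuous_subspaceT; exact: continuous_theta0.
- move=> z /andP[xz _]; rewrite normrN; apply: le_trans (sin_le_norm _) _.
  by rewrite ger0_norm ?(ltW (theta0_gt0 hbeta _))// theta0_ninc// ltW.
Qed.

(** The factor of order [1 / x] from the differentiated cutoffs multiplies [theta0 - beta], which is
    at most [beta] and at most [beta * x] in absolute value. The square of
    [(theta0 - beta) / (beta * x)] is then at most [min(1, 1 / x^2)], hence at most twice the
    weight. This is the dominating function, uniform in [n], for the convergence in [L^2]. *)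
Lemma dtheta0_test_bound : exists C, forall n (x : R), 0 < x ->
  (dtheta0_test n x + sin (theta0 beta x)) ^+ 2 <= C * (oneDsqr x)^-1.
Proof.
have /andP[b0 bp] := hbeta; have [_ eb _ _ _] := heta.
have [M M0 dM] := derive_cutoff_bounded.
(* Uniformly in the scale N, the derivative of eta (N x - 1) is O(1/x). *)
have dM1 (y : R) : 0 < y -> `|y * deta (y + -1)| <= 2 * M.
  move=> y0; rewrite normrM gtr0_norm//; have [y2|y2] := leP y 2.
    by apply: ler_pM => //; exact: ltW.
  by rewrite derive_cutoff_eq0 ?normr0 ?mulr0 ?mulr_ge0// ?ltW//; right; lra.
(* Twice the sum of [8 * beta], from [sin^2 theta0 <= beta * theta0], and [2 * 16 * M^2], from the
   differentiated cutoffs; the factor 2 comes from [(k + l)^2 <= 2 (k^2 + l^2)]. *)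
exists (16 * beta + 64 * M ^+ 2) => n x x0; pose N : R := n.+1%:R.
have N0 : 0 < N by rewrite ltr0n.
have x0' : 0 <= x := ltW x0.
have th0 := theta0_gt0 hbeta x; have thb := theta0_le hbeta x0'.
set s := sin (theta0 beta x); set v := theta0 beta x - beta.
set a := beta^-1 * eta (N^-1 * x + -1); set b := beta^-1 * eta (N * x + -1).
set p := N^-1 * x * deta (N^-1 * x + -1); set q := N * x * deta (N * x + -1).
have unit (y : R) : 0 <= beta^-1 * eta y <= 1.
  have /andP[h1 h2] := eb y.
  by rewrite mulr_ge0 ?invr_ge0 ?(ltW b0)//= ler_pdivrMl// mulr1.
have /andP[a0 a1] : 0 <= a <= 1 by exact: unit.
have /andP[bb0 b1] : 0 <= b <= 1 by exact: unit.
have pM : `|p| <= 2 * M by apply: dM1; rewrite mulr_gt0// invr_gt0.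
have qM : `|q| <= 2 * M by apply: dM1; rewrite mulr_gt0.
have -> : dtheta0_test n x + s =
    s * (1 - a * (1 - b)) + v / (beta * x) * (p * (1 - b) - a * beta * (q / beta)).
  rewrite /dtheta0_test -/s -/v -/N /p /q /a /b.
  by field; rewrite !gt_eqF.
have w0 : 0 < (oneDsqr x)^-1 by rewrite invr_gt0 (lt_le_trans ltr01)// oneDsqr_ge1.
have s2 : s ^+ 2 <= 8 * beta * (oneDsqr x)^-1.
  have := theta0_le_oneDsqrV hbeta x0'; have := sin_le_norm (theta0 beta x).
  rewrite -/s (gtr0_norm th0) => h1 h2.
  rewrite -real_normK ?num_real//.
  apply: (@le_trans _ _ (theta0 beta x * beta)).
    by apply: ler_pM => //; exact: le_trans thb.
  by rewrite [leRHS]mulrAC ler_pM2r.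
have v1 : `|v| <= beta.
  by rewrite /v ler_norml; apply/andP; split; lra.
have v2 : `|v| <= beta * x.
  have := @theta0_lipschitz 0 x; rewrite lexx x0' theta0_0// subr0; exact.
have v3 : (v / (beta * x)) ^+ 2 <= 2 * (oneDsqr x)^-1.
  rewrite exprMn exprVn ler_pdivlMr; last first.
    by rewrite (lt_le_trans ltr01)// oneDsqr_ge1.
  rewrite mulrAC ler_pdivrMr ?exprn_gt0 ?mulr_gt0//.
  have h1 : v ^+ 2 <= beta ^+ 2 by rewrite -real_normK ?num_real// lerXn2r ?nnegrE// ltW.
  have h2 : v ^+ 2 <= (beta * x) ^+ 2.
    by rewrite -[X in X <= _]real_normK ?num_real// lerXn2r ?nnegrE// mulr_ge0// ltW.
  have h3 : v ^+ 2 * x ^+ 2 <= beta ^+ 2 * x ^+ 2 by rewrite ler_wpM2r// sqr_ge0.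
  by rewrite /oneDsqr mulrDr mulr1; rewrite exprMn in h2 *; lra.
have r2 : (p * (1 - b) - a * beta * (q / beta)) ^+ 2 <= 16 * M ^+ 2.
  have -> : a * beta * (q / beta) = a * q by field; rewrite gt_eqF.
  rewrite -[X in X <= _]real_normK ?num_real//.
  have -> : 16 * M ^+ 2 = (4 * M) ^+ 2 by ring.
  rewrite lerXn2r ?nnegrE//; first by rewrite mulr_ge0// ltW.
  apply: le_trans (ler_normB _ _) _; rewrite (normrM p) (normrM a).
  rewrite (ger0_norm a0) (ger0_norm (_ : 0 <= 1 - b)); last lra.
  have h1 : `|p| * (1 - b) <= `|p| * 1 by rewrite ler_wpM2l//; lra.
  have h2 : a * `|q| <= 1 * `|q| by rewrite ler_wpM2r.
  lra.
set t := v / (beta * x); set r := p * (1 - b) - _.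
have t2r2 : (t * r) ^+ 2 <= 2 * (oneDsqr x)^-1 * (16 * M ^+ 2).
  by rewrite exprMn; apply: ler_pM; rewrite ?sqr_ge0.
have sab : (s * (1 - a * (1 - b))) ^+ 2 <= s ^+ 2.
  rewrite exprMn ler_piMr ?sqr_ge0//.
  have ab0 : 0 <= a * (1 - b) by rewrite mulr_ge0//; lra.
  have ab1 : a * (1 - b) <= 1 * 1 by apply: ler_pM; lra.
  by rewrite expr_le1//; lra.
have := sqr_ge0 (s * (1 - a * (1 - b)) - t * r).
move: (s * _) sab t2r2 => k; lra.
Qed.

Lemma theta0_admissible : admissible beta (theta0 beta).
Proof.
have /andP[b0 _] := hbeta.
split; first by apply: continuous_subspaceT; exact: continuous_theta0.
have ms : measurable_fun (Rpos R) (fun x => - sin (theta0 beta x)).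
  apply: measurable_funN; apply: measurable_sin_comp; apply: measurable_funTS.
  by apply: continuous_measurable_fun; exact: continuous_theta0.
exists (fun x => - sin (theta0 beta x)); split=> //.
exists theta0_test; split.
- exact: test_function_theta0_test.
- have [C CP] := dtheta0_test_bound.
  pose f_ n (x : R) : \bar R := ((dtheta0_test n x - - sin (theta0 beta x)) ^+ 2)%:E.
  have fE n : (\int[@lebesgue_measure R]_(x in Rpos R)
      (((theta0_test n)^`()%classic x - - sin (theta0 beta x)) ^+ 2)%:E =
    \int[@lebesgue_measure R]_(x in Rpos R) f_ n x)%E.
    apply: eq_integral => x _; rewrite derive1E.
    by have [_ ->] := is_derive_theta0_test n x.
  have mfn n : measurable_fun (Rpos R) (f_ n).
    apply/measurable_EFinP; apply: measurable_funX; apply: measurable_funB => //.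
    rewrite (_ : dtheta0_test n = (theta0_test n)^`()%classic).
      apply: measurable_funTS; apply: continuous_measurable_fun.
      exact: continuous_derive_test_function (test_function_theta0_test n).
    by apply/funext => x; rewrite derive1E; have [_ ->] := is_derive_theta0_test n x.
  have mf : measurable_fun (Rpos R) (fun _ : R => 0%E : \bar R).
    exact: measurable_cst.
  have f_f : {ae @lebesgue_measure R, forall x, Rpos R x ->
      f_ ^~ x @ \oo --> (0%E : \bar R)}.
    apply: aeW => x; rewrite /Rpos /= in_itv/= andbT => x0.
    apply: cvg_near_cst; near=> n; rewrite /f_.
    have [_ ->] : theta0_test n x = theta0 beta x - beta /\
      dtheta0_test n x = - sin (theta0 beta x).
      by near: n; exact: theta0_test_eventually.
    by rewrite subrr expr0n.
  have iw : (@lebesgue_measure R).-integrable (Rpos R)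
      (fun x => (C%:E * ((oneDsqr x)^-1)%:E)%E).
    apply: integrableZl; first exact: measurable_Rpos.
    exact: integrable_oneDsqrV.
  have f_w : {ae @lebesgue_measure R, forall x n, Rpos R x ->
      (`|f_ n x| <= C%:E * ((oneDsqr x)^-1)%:E)%E}.
    apply: aeW => x n; rewrite /Rpos /= in_itv/= andbT => x0.
    rewrite /f_ /= ger0_norm ?sqr_ge0// opprK -EFinM lee_fin; exact: CP.
  have [_ _] := dominated_convergence (mu := @lebesgue_measure R)
    (@measurable_Rpos R) mfn mf f_f iw f_w.
  rewrite integral0; apply: cvg_trans; apply: near_eq_cvg; apply: nearW => n.
  exact/esym/fE.
- move=> x; rewrite le_eqVlt => /predU1P[<-|x0].
    apply: cvg_near_cst; apply: nearW => n.
    by rewrite /theta0_test theta0_0// subrr !mul0r.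
  apply: cvg_near_cst; near=> n.
  apply: (proj1 (B := dtheta0_test n x = - sin (theta0 beta x))).
  by near: n; exact: theta0_test_eventually.
Unshelve. all: by end_near. Qed.

End cutoff.

(** * The nonlocal term and the renormalized potential *)

Section integral_comparison.
Context d (X : measurableType d) (R : realType).
Variables (mu : {measure set X -> \bar R}) (D : set X).

(** The integral of a nonnegative function is a supremum over the simple functions below it, so it
    is monotone whether or not the function is measurable. This bounds the double integral without
    studying how the inner one depends on [y]. *)
Lemma ge0_le_integral_nonmeasurable (f1 f2 : X -> \bar R) :
  (forall x, D x -> (0 <= f1 x)%E) -> (forall x, D x -> (f1 x <= f2 x)%E) ->
  (\int[mu]_(x in D) f1 x <= \int[mu]_(x in D) f2 x)%E.
Proof.
move=> f10 f12; rewrite !(integral_mkcond D).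
have h10 x : (0 <= (f1 \_ D) x)%E by apply: erestrict_ge0.
have h12 x : ((f1 \_ D) x <= (f2 \_ D) x)%E.
  by rewrite !patchE; case: ifPn => // /set_mem; exact: f12.
rewrite !ge0_integralTE//; last by move=> x; exact: le_trans (h12 x).
apply: le_ereal_sup => _ [h hf <-]; exists h => // x.
exact: le_trans (hf x) (h12 x).
Qed.

(** The negative part of [f] is at most [k], hence has a finite integral, and [h + f^- <= f^+ + k]
    pointwise. The integral of [h] may be infinite. *)
Lemma integral_ge_sub (f h k : X -> R) (K : R) : measurable D ->
  measurable_fun D f -> measurable_fun D h -> measurable_fun D k ->
  (forall x, D x -> 0 <= h x) -> (forall x, D x -> 0 <= k x) ->
  (forall x, D x -> h x - k x <= f x) ->
  (\int[mu]_(x in D) (k x)%:E = K%:E)%E ->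
  (\int[mu]_(x in D) (h x)%:E - K%:E <= \int[mu]_(x in D) (f x)%:E)%E.
Proof.
move=> mD mf mh mk h0 k0 hkf kK.
have mfE : measurable_fun D (EFin \o f) by exact/measurable_EFinP.
have mhE : measurable_fun D (EFin \o h) by exact/measurable_EFinP.
have mkE : measurable_fun D (EFin \o k) by exact/measurable_EFinP.
rewrite [leRHS]integralE.
have mfp := measurable_funepos mfE; have mfn := measurable_funeneg mfE.
have fk : (\int[mu]_(x in D) (EFin \o f)^\- x <= K%:E)%E.
  rewrite -kK; apply: ge0_le_integral => // x Dx.
  rewrite funenegE /= ge_max !lee_fin k0// andbT.
  by have := hkf _ Dx; have := h0 _ Dx; lra.
have fin : (\int[mu]_(x in D) (EFin \o f)^\- x)%E \is a fin_num.
  by rewrite ge0_fin_numE ?integral_ge0//; exact: le_lt_trans fk (ltry _).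
rewrite leeBlDr// -addeAC leeBrDr//.
have pk x : D x -> (0 <= (k x)%:E)%E by move=> Dx; rewrite lee_fin k0.
have ph x : D x -> (0 <= (h x)%:E)%E by move=> Dx; rewrite lee_fin h0.
rewrite -kK -!ge0_integralD//.
apply: ge0_le_integral => //.
- by move=> x Dx; rewrite adde_ge0 ?ph.
- exact: emeasurable_funD.
- exact: emeasurable_funD.
- move=> x Dx; have := hkf _ Dx; rewrite funeposE funenegE /=.
  rewrite -!EFin_max -!EFinD lee_fin => H.
  by have [|] := leP (f x) 0; have [|] := leP (- f x) 0; lra.
Qed.

End integral_comparison.

Section nonlocal.
Variables (R : realType) (beta : R).
Notation mu := (@lebesgue_measure R).
Let w (x : R) : R := (oneDsqr x)^-1.

Let w_gt0 x : 0 < w x.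
Proof. exact: oneDsqrV_gt0. Qed.

Let measurable_w : measurable_fun (Rpos R) w.
Proof. exact: measurable_oneDsqrV. Qed.

Let integral_w : (\int[mu]_(x in Rpos R) (w x)%:E = (pi / 2)%:E)%E.
Proof. exact: integral_oneDsqrV. Qed.

(** Combining both increments bounds the quotient by [2 C^2 w(x)^2 / (1 + (x - y)^2)]. Peetre's
    inequality [w(x) <= 2 w(y) (1 + (x - y)^2)] then turns one factor [w(x)] into [w(y)], leaving a
    product of two integrable weights. *)
Let kernel_bound (C : R) (f : R -> R) (x y : R) : 0 <= x -> x <= y ->
  `|f x - f y| <= C * w x -> `|f x - f y| <= C * w x * (y - x) ->
  (f x - f y) ^+ 2 / (x - y) ^+ 2 <= 4 * C ^+ 2 * (w x * w y).
Proof.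
move=> x0; rewrite le_eqVlt => /predU1P[<- _ _|xy h1 h2].
  rewrite !subrr expr0n/= mul0r; apply: mulr_ge0.
    by apply: mulr_ge0 => //; exact: sqr_ge0.
  by apply: mulr_ge0; exact: ltW.
have d2 : 0 < (x - y) ^+ 2 by rewrite -sqrrN opprB exprn_gt0// subr_gt0.
rewrite ler_pdivrMr//.
have wE z : w z * (1 + z ^+ 2) = 1 := oneDsqrVK z.
have wx := w_gt0 x; have wy := w_gt0 y.
have a0 : 0 <= `|f x - f y| := normr_ge0 _.
have k1 : (f x - f y) ^+ 2 <= C ^+ 2 * w x ^+ 2.
  by rewrite -real_normK ?num_real// -exprMn lerXn2r ?nnegrE//; exact: le_trans a0 h1.
have k2 : (f x - f y) ^+ 2 <= C ^+ 2 * w x ^+ 2 * (x - y) ^+ 2.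
  have -> : (x - y) ^+ 2 = (y - x) ^+ 2 by ring.
  rewrite -real_normK ?num_real// -!exprMn.
  by rewrite lerXn2r ?nnegrE//; exact: le_trans a0 h2.
have k3 : (f x - f y) ^+ 2 * (1 + (x - y) ^+ 2) <= 2 * C ^+ 2 * w x ^+ 2 * (x - y) ^+ 2.
  by have := ler_wpM2r (ltW d2) k1; lra.
have k4 : w x <= 2 * w y * (1 + (x - y) ^+ 2).
  have h : 1 <= w x * (2 * (1 + x ^+ 2)) by rewrite mulrCA wE; lra.
  have h' : 1 + y ^+ 2 <= 2 * (1 + x ^+ 2) * (1 + (x - y) ^+ 2).
    have := sqr_ge0 (x - (y - x)); have := mulr_ge0 (sqr_ge0 x) (ltW d2).
    by have := sqr_ge0 x; lra.
  rewrite -(ler_pM2r (_ : 0 < (1 + y ^+ 2) * (1 + x ^+ 2))); last first.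
    by rewrite mulr_gt0// (lt_le_trans ltr01)// lerDl sqr_ge0.
  rewrite (_ : w x * _ = w x * (1 + x ^+ 2) * (1 + y ^+ 2)); last by ring.
  rewrite (_ : 2 * w y * _ * _ = w y * (1 + y ^+ 2) * (2 * (1 + x ^+ 2) * (1 + (x - y) ^+ 2))); last by ring.
  by rewrite !wE; lra.
have c0 : 0 <= 2 * C ^+ 2 * w x * (x - y) ^+ 2.
  apply: mulr_ge0; last exact: sqr_ge0.
  apply: mulr_ge0; last exact: ltW.
  by apply: mulr_ge0 => //; exact: sqr_ge0.
have k5 := ler_wpM2l c0 k4.
have q0 : 0 < 1 + (x - y) ^+ 2 by rewrite addr_gt0.
rewrite -(ler_pM2r q0); lra.
Qed.

Lemma nonlocal_term_fin (C : R) (T : R -> R) :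
  (forall x y, 0 < x -> x <= y ->
    `|T x - T y| <= C * w x /\ `|T x - T y| <= C * w x * (y - x)) ->
  nonlocal_term beta T \is a fin_num.
Proof.
move=> TC; have mR := @measurable_Rpos R.
pose k x y := (sin (T x - beta) - sin (T y - beta)) ^+ 2 / (x - y) ^+ 2.
have k0 x y : 0 <= k x y by rewrite divr_ge0// sqr_ge0.
have kle x y : 0 < x -> x <= y -> k x y <= 4 * C ^+ 2 * (w x * w y).
  move=> x0 xy; have [h1 h2] := TC x y x0 xy.
  have h : `|sin (T x - beta) - sin (T y - beta)| <= `|T x - T y|.
    by apply: le_trans (sin_lipschitz _ _) _; rewrite opprB addrA subrK.
  by apply: (@kernel_bound C (fun x => sin (T x - beta))) => //;
    [exact: ltW|exact: le_trans h h1|exact: le_trans h h2].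
have kle' x y : Rpos R x -> Rpos R y -> k x y <= 4 * C ^+ 2 * (w x * w y).
  rewrite /Rpos /= !in_itv/= !andbT => x0 y0.
  have [xy|/ltW yx] := leP x y; first exact: kle.
  have -> : k x y = k y x by rewrite /k -sqrrN opprB -(sqrrN (x - y)) opprB.
  by rewrite (mulrC (w x)); exact: kle.
have C0 : 0 <= 4 * C ^+ 2 by rewrite mulr_ge0// sqr_ge0.
rewrite ge0_fin_numE; last first.
  apply: integral_ge0 => y _; apply: integral_ge0 => x _.
  by rewrite lee_fin; exact: k0.
apply: (@le_lt_trans _ _ (4 * C ^+ 2 * (pi / 2) * (pi / 2))%:E); last exact: ltry.
have -> : ((4 * C ^+ 2 * (pi / 2) * (pi / 2))%:E =
    \int[mu]_(y in Rpos R) ((4 * C ^+ 2 * (pi / 2))%:E * (w y)%:E))%E.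
  rewrite ge0_integralZl_EFin//.
  - by rewrite integral_w -EFinM.
  - by move=> y _; rewrite lee_fin ltW.
  - exact/measurable_EFinP.
  - by rewrite mulr_ge0// divr_ge0// pi_ge0.
apply: ge0_le_integral_nonmeasurable => y Ry.
  by apply: integral_ge0 => x _; rewrite lee_fin; exact: k0.
have -> : ((4 * C ^+ 2 * (pi / 2))%:E * (w y)%:E =
    \int[mu]_(x in Rpos R) ((4 * C ^+ 2 * w y)%:E * (w x)%:E))%E.
  rewrite ge0_integralZl_EFin//.
  - by rewrite integral_w -!EFinM; congr EFin; ring.
  - by move=> x _; rewrite lee_fin ltW.
  - exact/measurable_EFinP.
  - by rewrite mulr_ge0// ltW.
apply: ge0_le_integral_nonmeasurable => x Rx; rewrite lee_fin; first exact: k0.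
by have := kle' x y Rx Ry; rewrite (mulrC (w x)) mulrA.
Qed.

End nonlocal.

(** * Bounds on the renormalized energy *)

Section renormalized_energy.
Variables (R : realType) (beta : R) (eta : R -> R).
Notation mu := (@lebesgue_measure R).
Hypothesis hbeta : 0 < beta < pi / 2.
Hypothesis heta : cutoff beta eta.
Let w (x : R) : R := (oneDsqr x)^-1.

Let w_gt0 x : 0 < w x.
Proof. exact: oneDsqrV_gt0. Qed.

Let w_ge x : 0 <= x -> x <= 1 -> 1 <= 2 * w x.
Proof.
move=> x0 x1; rewrite -ler_pdivrMr ?w_gt0// invrK mul1r /oneDsqr.
by have : x ^+ 2 <= 1 by [rewrite expr_le1]; lra.
Qed.

Let wE x : w x * (1 + x ^+ 2) = 1.
Proof. exact: oneDsqrVK. Qed.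

Let integral_w : (\int[mu]_(x in Rpos R) (w x)%:E = (pi / 2)%:E)%E.
Proof. exact: integral_oneDsqrV. Qed.

Let continuous_cutoff : continuous eta.
Proof. by move=> x; exact: is_derive_continuous (is_derive_cutoff heta x). Qed.

Lemma cutoff_lipschitz : exists2 M, 0 < M &
  forall x y, x <= y -> `|eta y - eta x| <= M * (y - x).
Proof.
have [M M0 dM] := derive_cutoff_bounded heta; exists M => // x y xy.
apply: (@MVT_lipschitz R eta (eta^`()%classic)) => //.
- by move=> z _; exact: is_derive_cutoff heta z.
- exact: continuous_subspaceT.
Qed.

Lemma nonlocal_term_cutoff_fin : nonlocal_term beta eta \is a fin_num.
Proof.
have /andP[b0 _] := hbeta; have [_ eb _ e1 _] := heta.
have [M M0 etaM] := cutoff_lipschitz.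
(* For [x >= 1] both values of [eta] vanish. For [x < 1] the weight is at least [1/2], which the
   factor 2 compensates; [beta] bounds the increment and [M] its slope. *)
apply: (@nonlocal_term_fin R beta (2 * (beta + M))) => x y x0 xy.
have [x1|x1] := leP 1 x.
  have wx := w_gt0 x.
  rewrite !e1//; last exact: le_trans x1 xy.
  rewrite subrr normr0; split; first by apply: mulr_ge0; [lra|exact: ltW].
  by apply: mulr_ge0; [apply: mulr_ge0; [lra|exact: ltW]|lra].
have wx := w_ge (ltW x0) (ltW x1); have h := etaM _ _ xy.
have /andP[ex0 exb] := eb x; have /andP[ey0 eyb] := eb y.
rewrite distrC; split.
  have : `|eta y - eta x| <= beta by rewrite ler_norml; apply/andP; split; lra.
  have : (beta + M) * 1 <= (beta + M) * (2 * w x) by rewrite ler_wpM2l//; lra.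
  rewrite -/(w x); lra.
apply: le_trans h _; rewrite ler_wpM2r ?subr_ge0//.
have : (beta + M) * 1 <= (beta + M) * (2 * w x) by rewrite ler_wpM2l//; lra.
by rewrite -/(w x); lra.
Qed.

Lemma nonlocal_term_theta0_fin : nonlocal_term beta (theta0 beta) \is a fin_num.
Proof.
apply: (@nonlocal_term_fin R beta 8) => x y x0 xy.
have th0 z := theta0_gt0 hbeta z.
have thw := theta0_le_oneDsqrV hbeta (ltW x0).
split.
  rewrite ger0_norm ?subr_ge0 ?theta0_ninc//.
  by apply: le_trans thw; have := th0 y; lra.
rewrite distrC; apply: le_trans (theta0_lipschitz hbeta _) _; first by rewrite (ltW x0).
by rewrite ler_wpM2r// subr_ge0.
Qed.

Let q (T : R -> R) (x : R) : R :=
  ((sin (T x - beta)) ^+ 2 - (sin (eta x - beta)) ^+ 2) / x.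

Let measurable_q T : measurable_fun (Rpos R) T -> measurable_fun (Rpos R) (q T).
Proof.
move=> mT; apply: measurable_funM; last first.
  apply: open_continuous_measurable_fun; first exact: interval_open.
  move=> x; rewrite inE /Rpos /= in_itv/= andbT => x0.
  by apply: inv_continuous; rewrite gt_eqF.
apply: measurable_funB; apply: measurable_funX; apply: measurable_sin_comp;
  apply: measurable_funB => //.
by apply: measurable_funTS; exact: continuous_measurable_fun.
Qed.

Lemma sin2B (a b : R) : sin a ^+ 2 - sin b ^+ 2 = sin (a + b) * sin (a - b).
Proof.
rewrite sinD sinB; have := cos2Dsin2 a; have := cos2Dsin2 b.
move: (sin a) (cos a) (sin b) (cos b) => sa ca sb cb h1 h2.
have -> : cb ^+ 2 = 1 - sb ^+ 2 -> ca ^+ 2 = 1 - sa ^+ 2 ->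
  (sa * cb + ca * sb) * (sa * cb - ca * sb) = sa ^+ 2 - sb ^+ 2 => //; last 2 first.
- lra.
- lra.
move=> h3 h4; rewrite (_ : _ * _ = sa ^+ 2 * cb ^+ 2 - ca ^+ 2 * sb ^+ 2); last by ring.
by rewrite h3 h4; ring.
Qed.

Lemma sin2_lipschitz (a b : R) : `|sin a ^+ 2 - sin b ^+ 2| <= `|a - b|.
Proof.
rewrite sin2B normrM -[leRHS]mul1r; apply: ler_pM => //; first exact: sin_max.
exact: sin_le_norm.
Qed.

(* The renormalized potential may be negative, but only by an amount absorbed
   by the anisotropy and an integrable weight. *)
Lemma potential_ge : exists2 C, 0 <= C & forall T (x : R), 0 < x ->
  - (2^-1 * sin (T x) ^+ 2 + C * w x) <= q T x.
Proof.
have [M M0 etaM] := cutoff_lipschitz; have [_ _ e0 e1 _] := heta.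
exists (2 * M ^+ 2 + 1); first by rewrite addr_ge0// mulr_ge0// sqr_ge0.
move=> T x x0; have wx := w_gt0 x; have s2 := sqr_ge0 (sin (T x)).
have M2 := sqr_ge0 M.
(* Near 0, [eta] starts from [beta], so [sin^2 (eta - beta) / x <= M^2 x], which is at most
   [2 M^2 w] on []0, 1]]. *)
have [x1|/ltW x1] := leP x 1.
  have h : `|sin (eta x - beta)| <= M * x.
    apply: le_trans (sin_le_norm _) _.
    by rewrite -(e0 0)//; have := etaM 0 x (ltW x0); rewrite subr0.
  have h2 : sin (eta x - beta) ^+ 2 <= (M * x) ^+ 2.
    rewrite -real_normK ?num_real// lerXn2r ?nnegrE//.
    by rewrite mulr_ge0// ltW.
  rewrite /q ler_pdivlMr//.
  have := w_ge (ltW x0) x1; have := sqr_ge0 (sin (T x - beta)).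
  move=> h3 h4.
  have h5 : M ^+ 2 * x ^+ 2 <= M ^+ 2 * x.
    by rewrite ler_wpM2l// expr2 ler_piMl// ltW.
  have h6 : M ^+ 2 * x * 1 <= M ^+ 2 * x * (2 * w x).
    by rewrite ler_wpM2l// mulr_ge0// ltW.
  have h7 : 0 <= sin (T x) ^+ 2 * x by rewrite mulr_ge0// ltW.
  have h8 : 0 <= w x * x by rewrite mulr_ge0// ltW.
  rewrite exprMn in h2; lra.
(* Beyond 1 the numerator is [sin T * sin (T - 2 beta)]. Then
   [|sin T| / x <= sin^2 T / 2 + 1 / (2 x^2)], and [1 / (2 x^2) <= w] because [x >= 1]. *)
have h : `|sin (T x - beta) ^+ 2 - sin (eta x - beta) ^+ 2| <= `|sin (T x)|.
  rewrite e1// add0r sinN sqrrN sin2B subrK normrM -[leRHS]mulr1.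
  by apply: ler_pM => //; exact: sin_max.
rewrite /q ler_pdivlMr//.
have h2 : - `|sin (T x)| <= sin (T x - beta) ^+ 2 - sin (eta x - beta) ^+ 2.
  by move: h; rewrite ler_norml => /andP[].
apply: le_trans h2; rewrite mulNr lerN2.
have h3 : 0 <= M ^+ 2 * w x * x by rewrite !mulr_ge0// ltW.
have h4 : `|sin (T x)| <= 2^-1 * sin (T x) ^+ 2 * x + w x * x.
  have x2 : 1 <= x ^+ 2 by rewrite expr_ge1// ltW.
  have h5 : 1 <= 2 * (w x * x ^+ 2).
    have h6 : w x * 1 <= w x * x ^+ 2 by rewrite ler_wpM2l// ltW.
    by have := wE x; lra.
  rewrite -[sin (T x) ^+ 2]real_normK ?num_real//.
  move: `|sin (T x)| (normr_ge0 (sin (T x))) => s s0.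
  have h7 := sqr_ge0 (s * x - 1).
  rewrite -(ler_pM2r x0); lra.
by lra.
Qed.

Lemma potential_theta0_le : exists2 C, 0 <= C & forall x : R, 0 < x ->
  `|q (theta0 beta) x| <= C * w x.
Proof.
have /andP[b0 _] := hbeta.
have [M M0 etaM] := cutoff_lipschitz; have [_ _ e0 e1 _] := heta.
(* On []0, 1]] both [theta0] and [eta] start from [beta], with slopes at most [beta] and [M], and
   [1 <= 2 w]. Beyond 1, [eta] vanishes and [theta0 <= 8 w]. *)
exists (2 * (beta + M) + 8); first by lra.
move=> x x0; have wx := w_gt0 x.
rewrite /q normrM normfV (gtr0_norm x0) ler_pdivrMr//.
apply: le_trans (sin2_lipschitz _ _) _.
rewrite opprB addrA subrK.
have th0 := theta0_gt0 hbeta x.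
have [x1|/ltW x1] := leP x 1.
  have h1 : `|theta0 beta x - beta| <= beta * x.
    have := @theta0_lipschitz R beta hbeta 0 x.
    by rewrite lexx (ltW x0) theta0_0// subr0; exact.
  have h2 : `|eta x - beta| <= M * x.
    by have := etaM 0 x (ltW x0); rewrite subr0 (e0 0).
  have h3 : `|theta0 beta x - eta x| <= (beta + M) * x.
    rewrite (_ : _ - _ = (theta0 beta x - beta) - (eta x - beta)); last by ring.
    by apply: le_trans (ler_normB _ _) _; lra.
  have h4 := w_ge (ltW x0) x1.
  have h5 : (beta + M) * x * 1 <= (beta + M) * x * (2 * w x).
    by rewrite ler_wpM2l// mulr_ge0//; [lra|exact: ltW].
  have h6 : 0 <= w x * x by rewrite mulr_ge0// ltW.
  lra.
rewrite e1// subr0 gtr0_norm//.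
have h1 := theta0_le_oneDsqrV hbeta (ltW x0); rewrite -/(w x) in h1.
have h2 : w x * 1 <= w x * x by rewrite ler_wpM2l// ltW.
have h3 : 0 <= (beta + M) * (w x * x).
  by rewrite mulr_ge0 ?mulr_ge0//; [lra|exact: ltW|exact: ltW].
lra.
Qed.

Let p : R := (4 * pi)^-1.

Let p_ge0 : 0 <= p.
Proof. by rewrite invr_ge0 mulr_ge0// pi_ge0. Qed.

Let p_le1 : p <= 1.
Proof. by rewrite invf_le1; have := @pi_ge2 R; lra. Qed.

Let measurable_w : measurable_fun (Rpos R) w.
Proof. exact: measurable_oneDsqrV. Qed.

Let integral_cw (c : R) : 0 <= c ->
  (\int[mu]_(x in Rpos R) (c * w x)%:E = (c * (pi / 2))%:E)%E.
Proof.
move=> c0; under eq_integral do rewrite EFinM.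
have mR := @measurable_Rpos R.
rewrite ge0_integralZl_EFin//.
- by rewrite integral_w.
- by move=> x _; rewrite lee_fin ltW.
- exact/measurable_EFinP.
Qed.

(** The potential costs at most [nu (sin^2 T / 2 + C w)]. Giving up the same fraction [nu] of the
    gradient term leaves a multiple of the whole energy, which may still be infinite at this stage;
    hence [integral_ge_sub]. *)
Lemma local_term_ge : exists2 C, 0 <= C & forall nu T, 0 < nu < 1 ->
  admissible beta T ->
  ((1 - nu)%:E * energy0 beta T - (nu * C)%:E <= local_term beta nu eta T)%E.
Proof.
have [C C0 qC] := potential_ge.
exists (C * (pi / 2)); first by rewrite mulr_ge0// divr_ge0// pi_ge0.
move=> nu T /andP[nu0 nu1] TA.
have mR := @measurable_Rpos R.
have mg := measurable_deriv_adm TA; have [Tc _] := TA.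
have mT := within_Rpos_measurable Tc.
pose A x := 2^-1 * deriv_adm beta T x ^+ 2 + 2^-1 * sin (T x) ^+ 2.
have mA : measurable_fun (Rpos R) A.
  by apply: measurable_funD; apply: measurable_funM => //;
    apply: measurable_funX => //; exact: measurable_sin_comp.
have A0 x : 0 <= A x by rewrite addr_ge0// mulr_ge0// sqr_ge0.
have -> : ((1 - nu)%:E * energy0 beta T =
    \int[mu]_(x in Rpos R) ((1 - nu) * A x)%:E)%E.
  rewrite energy0E//; under [RHS]eq_integral do rewrite EFinM.
  rewrite ge0_integralZl_EFin//.
  - by move=> x _; rewrite lee_fin.
  - exact/measurable_EFinP.
  - by rewrite subr_ge0 ltW.
have nuC0 : 0 <= nu * C by rewrite mulr_ge0// ltW.
rewrite mulrA; apply: (@integral_ge_sub _ _ R mu (Rpos R)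
  (fun x => A x + nu / (4 * pi) * q T x) (fun x => (1 - nu) * A x)
  (fun x => nu * C * w x)) => //.
- by apply: measurable_funD => //; apply: measurable_funM => //; exact: measurable_q.
- exact: measurable_funM.
- exact: measurable_funM.
- by move=> x _; rewrite mulr_ge0// subr_ge0 ltW.
- by move=> x _; rewrite mulr_ge0// ltW.
- move=> x; rewrite /Rpos /= in_itv/= andbT => x0.
  have := qC T x x0; rewrite -/p; set Q := q T x => h.
  have g2 := sqr_ge0 (deriv_adm beta T x); have s2 := sqr_ge0 (sin (T x)).
  have B0 : 0 <= 2^-1 * sin (T x) ^+ 2 + C * w x.
    by rewrite addr_ge0// mulr_ge0// ltW.
  have h1 : - (2^-1 * sin (T x) ^+ 2 + C * w x) <= p * Q.
    have := ler_wpM2l p_ge0 h.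
    have := ler_wpM2r B0 p_le1; lra.
  have h2 := ler_wpM2l (ltW nu0) h1.
  have h3 : 0 <= nu * deriv_adm beta T x ^+ 2 by rewrite mulr_ge0// ltW.
  by rewrite /A; lra.
- exact: integral_cw.
Qed.

Lemma local_term_theta0_le : exists2 C, 0 <= C & forall nu, 0 < nu ->
  (local_term beta nu eta (theta0 beta) <= (1 - cos beta + nu * C)%:E)%E.
Proof.
have [C C0 qC] := potential_theta0_le.
exists (C * (pi / 2)); first by rewrite mulr_ge0// divr_ge0// pi_ge0.
move=> nu nu0; have TA := theta0_admissible hbeta heta.
have mR := @measurable_Rpos R.
have mg := measurable_deriv_adm TA; have [Tc _] := TA.
have mT := within_Rpos_measurable Tc.
pose A x := 2^-1 * deriv_adm beta (theta0 beta) x ^+ 2 +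
  2^-1 * sin (theta0 beta x) ^+ 2.
have mA : measurable_fun (Rpos R) A.
  by apply: measurable_funD; apply: measurable_funM => //;
    apply: measurable_funX => //; exact: measurable_sin_comp.
have A0 x : 0 <= A x by rewrite addr_ge0// mulr_ge0// sqr_ge0.
have AE : (\int[mu]_(x in Rpos R) (A x)%:E = (1 - cos beta)%:E)%E.
  by rewrite -energy0_theta0// energy0E.
(* The potential has no sign, so the integral is split by integrability of the two parts rather than
   by positivity. *)
have iA : mu.-integrable (Rpos R) (EFin \o A).
  apply/integrableP; split; first exact/measurable_EFinP.
  under eq_integral => x _ do rewrite gee0_abs ?lee_fin//.
  by rewrite AE ltry.
pose B x := nu * p * q (theta0 beta) x.
have mB : measurable_fun (Rpos R) B.
  by apply: measurable_funM => //; exact: measurable_q.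
have icw : mu.-integrable (Rpos R) (EFin \o (fun x => nu * C * w x)).
  apply/integrableP; split.
    by apply/measurable_EFinP; exact: measurable_funM.
  under eq_integral => x _ do rewrite gee0_abs ?lee_fin ?mulr_ge0 ?(ltW nu0) ?(ltW (w_gt0 _))//.
  by rewrite integral_cw ?ltry// mulr_ge0// ltW.
have BC x : Rpos R x -> `|B x| <= nu * C * w x.
  rewrite /Rpos /= in_itv/= andbT => x0.
  rewrite /B normrM ger0_norm; last by rewrite mulr_ge0// ltW.
  rewrite -!mulrA ler_pM2l// -[leRHS]mul1r; apply: ler_pM => //.
  exact: qC.
have iB : mu.-integrable (Rpos R) (EFin \o B).
  apply: le_integrable icw => //; first exact/measurable_EFinP.
  move=> x Rx; rewrite /= lee_fin; apply: le_trans (BC x Rx) _.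
  exact: ler_norm.
have -> : local_term beta nu eta (theta0 beta) =
    (\int[mu]_(x in Rpos R) ((A x)%:E + (B x)%:E))%E by [].
rewrite integralD_EFin// AE [leRHS]EFinD; apply: leeD => //.
rewrite mulrA -integral_cw; last by rewrite mulr_ge0// ltW.
apply: le_integral => // x Rx; rewrite /= lee_fin.
by apply: le_trans (ler_norm _) _; apply: BC; exact: set_mem.
Qed.

Lemma nonlocal_term_ge0 (T : R -> R) : (0 <= nonlocal_term beta T)%E.
Proof.
apply: integral_ge0 => y _; apply: integral_ge0 => x _.
by rewrite lee_fin divr_ge0// sqr_ge0.
Qed.

(** The cutoff term is finite and cancels from both sides. The nonlocal term of [T], possibly
    infinite, is discarded by its sign, while that of [theta0] is finite and adds at most
    [nu * r0]. *)
Lemma energy0_le_of_energy_le : exists2 C, 0 <= C & forall nu T, 0 < nu < 1 ->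
  admissible beta T ->
  (energy beta nu eta T <= energy beta nu eta (theta0 beta))%E ->
  ((1 - nu)%:E * energy0 beta T <= (1 - cos beta + nu * C)%:E)%E.
Proof.
have [C1 C10 h1] := local_term_ge.
have [C2 C20 h2] := local_term_theta0_le.
have := nonlocal_term_theta0_fin; have := nonlocal_term_ge0 (theta0 beta).
rewrite /energy; case: (nonlocal_term beta (theta0 beta)) => // r0 r00 _.
have := nonlocal_term_cutoff_fin; case: (nonlocal_term beta eta) => // r _.
rewrite lee_fin in r00.
exists (C1 + C2 + r0); first by rewrite !addr_ge0.
move=> nu T nu01 TA; have /andP[nu0 nu1] := nu01.
set k := nu / (8 * pi).
have pi2 := @pi_ge2 R.
have k0 : 0 <= k by rewrite divr_ge0 ?(ltW nu0)// mulr_ge0// pi_ge0.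
have k1 : k <= nu by rewrite ler_pdivrMr ?ler_peMr ?(ltW nu0)//; lra.
rewrite leeBrDr// subeK// => hle.
have hL : (local_term beta nu eta T <= (1 - cos beta + nu * C2 + k * r0)%:E)%E.
  apply: (@le_trans _ _ (local_term beta nu eta T + k%:E * nonlocal_term beta T)%E).
    by rewrite leeDl// mule_ge0// ?lee_fin// nonlocal_term_ge0.
  apply: le_trans hle _; rewrite -EFinM [leRHS]EFinD; apply: leeD => //.
  exact: h2.
have := le_trans (h1 nu T nu01 TA) hL; rewrite leeBlDr// -EFinD.
move/le_trans; apply; rewrite lee_fin.
have : k * r0 <= nu * r0 by rewrite ler_wpM2r.
lra.
Qed.

End renormalized_energy.

(** * Uniform convergence to the unique limit minimizer *)

Theorem theorem3 (R : realType) (beta : R) (eta : R -> R)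
    (theta : R -> R -> R)
    (hbeta : 0 < beta < pi / 2)
    (heta : cutoff beta eta)
    (htheta : forall nu : R, 0 < nu ->
       minimizer (admissible beta) (energy beta nu eta) (theta nu)) :
  [/\ {uniform Rpos_closed R, theta nu @[nu --> 0^'+] --> theta0 beta},
      minimizer (admissible beta) (energy0 beta) (theta0 beta) &
      forall t : R -> R, minimizer (admissible beta) (energy0 beta) t ->
        forall x : R, 0 <= x -> t x = theta0 beta x].
Proof.
have TA := theta0_admissible hbeta heta.
have /andP[b0 bp] := hbeta; have p0 := @pi_gt0 R.
have cb0 : 0 < cos beta by rewrite cos_gt0_pihalf//; lra.
split.
- have [C C0 hC] := energy0_le_of_energy_le hbeta heta.
  move=> P /uniform_nbhs[E [entE EP]].
  move: entE => /= -[eps /= eps0 epsE].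
  (* The first bound keeps the level [1 - cos beta + d] at most 1; the second makes the stability
     estimate yield a distance of at most [eps / 2]. *)
  pose d := Num.min (cos beta) (cos beta / 2 * (eps / 2) ^+ 2).
  have d0 : 0 < d by rewrite lt_min cb0 mulr_gt0 ?exprn_gt0 ?divr_gt0.
  have dcb : d <= cos beta by rewrite ge_min lexx.
  have deps : d <= cos beta / 2 * (eps / 2) ^+ 2 by rewrite ge_min lexx orbT.
  near=> nu; apply: EP => x; rewrite /Rpos_closed /= in_itv/= andbT => x0.
  apply: epsE => /=.
  have nu0 : 0 < nu by near: nu; exact: nbhs_right_gt.
  have nu1 : nu < 1 by near: nu; exact: nbhs_right_lt.
  (* The target [1 - cos beta + nu C < (1 - nu) (1 - cos beta + d)] amounts to
     [nu (C + 1 - cos beta + d) < d], and [d <= cos beta] reduces it to [nu (C + 1) < d]. *)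
  have nuC : nu < d / (C + 1).
    by near: nu; apply: nbhs_right_lt; rewrite divr_gt0//; lra.
  have [nuA numin] := htheta nu nu0.
  have := hC nu (theta nu) _ nuA; rewrite nu0 nu1 => /(_ isT) hE.
  have {}hE : ((1 - nu)%:E * energy0 beta (theta nu) <=
      (1 - cos beta + nu * C)%:E)%E.
    by apply: hE; rewrite numin; apply: ereal_inf_lbound; exists (theta0 beta).
  have En : (energy0 beta (theta nu) < (1 - cos beta + d)%:E)%E.
    rewrite -(@lte_pmul2l _ (1 - nu)%:E)//; last by rewrite lte_fin; lra.
    apply: le_lt_trans hE _; rewrite -EFinM lte_fin.
    rewrite ltr_pdivlMr in nuC; last lra.
    nra.
  have st := energy0_stability hbeta nuA En _ x0.
  have {}st := st ltac:(lra).
  have h : (theta nu x - theta0 beta x) ^+ 2 <= (eps / 2) ^+ 2.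
    by rewrite -(@ler_pM2l _ (cos beta / 2)); lra.
  rewrite /ball /= distrC; apply: (@le_lt_trans _ _ (eps / 2)); last lra.
  by rewrite -ler_sqr ?nnegrE// ?real_normK ?num_real//; lra.
- split=> //; apply/eqP; rewrite eq_le; apply/andP; split.
    rewrite energy0_theta0//; apply: le_ereal_inf_tmp => _ [t tA <-].
    exact: energy0_ge.
  by apply: ereal_inf_lbound; exists (theta0 beta).
- move=> t [tA tmin]; apply: energy0_eq => //.
  rewrite tmin -(energy0_theta0 hbeta TA).
  by apply: ereal_inf_lbound; exists (theta0 beta).
Unshelve. all: by end_near. Qed.
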